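(* Let $\rho:\mathbb{C}\to\mathbb{C}$ be a quasiconformal mapping, analytic at $\infty$, such that $$\int_{\mathbb{C}}\frac{|\overline{\partial}\rho(z)|^2}{|y|}\,dm(z)<\infty,\qquad y=\operatorname{Im} z.$$ Then $\Gamma=\rho(\mathbb{R})$ is locally rectifiable and $\rho'|_{\mathbb{R}}\in L^2_{\mathrm{loc}}(\mathbb{R})$.
   Context: $dm$ is Lebesgue measure on $\mathbb{C}$. A quasiconformal mapping (of the plane) is an orientation-preserving homeomorphism $\rho:\mathbb{C}\to\mathbb{C}$ in $W^{1,2}_{\mathrm{loc}}(\mathbb{C})$ satisfying $\overline{\partial}\rho=\mu\,\partial\rho$ a.e. for some measurable $\mu$ with $\|\mu\|_\infty<1$. ''$\rho$ analytic at $\infty$'' means that $\rho$, extended by $\rho(\infty)=\infty$, is holomorphic in a neighbourhood of $\infty$ in the Riemann sphere. The curve $\Gamma=\rho(\mathbb{R})$ passes through $\infty$; locally rectifiable means that $\rho(I)$ has finite length for each bounded interval $I$. The notation $\rho'|_{\mathbb{R}}\in L^2_{\mathrm{loc}}(\mathbb{R})$ means that the restriction of $\rho$ to $\mathbb{R}$ has a (weak) derivative that is locally square integrable on $\mathbb{R}$. *)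

(* Defs.v *)
From HB Require Import structures.
From mathcomp Require Import all_boot all_order all_algebra.
From mathcomp Require Import all_classical all_reals all_analysis ess_sup_inf.
From mathcomp Require Import complex.

Set Implicit Arguments.
Unset Strict Implicit.
Unset Printing Implicit Defensive.

Import Order.TTheory GRing.Theory Num.Theory.
Import numFieldNormedType.Exports.
Import Normc.

Local Open Scope classical_set_scope.
Local Open Scope ring_scope.
Local Open Scope complex_scope.

Section TestFunctions.
Context {R : realType}.

(* Class C^n; for E = R and E = R * R, the derivatives in all directions
   together carry the same information as the partial derivatives. *)
Fixpoint is_Cn {E : normedModType R} (n : nat) (f : E -> R) : Prop :=
  continuous f /\
  match n with
  | 0%N => True
  | m.+1 => forall v : E, (forall x, derivable f x v) /\ is_Cn m ('D_v f)
  end.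

Definition test_function {E : normedModType R} (phi : E -> R) : Prop :=
  (forall n, is_Cn n phi) /\ compact (closure [set x | phi x != 0]).

End TestFunctions.

Section Line.
Context {R : realType}.
Local Notation C := R[i]^o.
Local Notation leb := (@lebesgue_measure R).

Definition weak_deriv_line (u v : R -> R) : Prop :=
  forall phi : R -> R, test_function phi ->
    \int[leb]_x (u x * 'D_1 phi x) = - \int[leb]_x (v x * phi x).

Definition weak_derivC_line (f g : R -> C) : Prop :=
  weak_deriv_line (fun x => complex.Re (f x)) (fun x => complex.Re (g x)) /\
  weak_deriv_line (fun x => complex.Im (f x)) (fun x => complex.Im (g x)).

Definition L2loc_line (g : R -> C) : Prop :=
  [/\ measurable_fun setT (fun x => complex.Re (g x)),
      measurable_fun setT (fun x => complex.Im (g x)) &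
      forall K : set R, compact K ->
        (\int[leb]_(x in K) (normc (g x) ^+ 2)%:E < +oo)%E].

(* Length of the curve gamma over I, as the supremum of the lengths of the
   inscribed polygonal lines with nodes in I; when gamma is injective this is
   the length of the arc gamma @` I. *)
Definition curve_length (gamma : R -> C) (I : set R) : \bar R :=
  ereal_sup [set l | exists (n : nat) (t : nat -> R),
    [/\ forall k, (k <= n)%N -> I (t k),
        forall k, (k < n)%N -> t k <= t k.+1 &
        l = (\sum_(k < n) normc (gamma (t k.+1) - gamma (t k)))%:E]].

Definition locally_rectifiable (gamma : R -> C) : Prop :=
  forall I : set R, is_interval I -> bounded_set I ->
    (curve_length gamma I < +oo)%E.

End Line.

(* dm(x + i y) is dx dy: integrals over the complex plane are written as
   integrals over R * R, composing with toC below. *)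
Notation lebesgue2 R := ((@lebesgue_measure R) \x (@lebesgue_measure R))%E.

Section Plane.
Context {R : realType}.
Local Notation C := R[i]^o.

Definition toC (p : R * R) : C := p.1 +i* p.2.

Local Notation leb2 := (lebesgue2 R).

Definition weak_deriv_plane (v : R * R) (u w : R * R -> R) : Prop :=
  forall phi : R * R -> R, test_function phi ->
    \int[leb2]_p (u p * 'D_v phi p) = - \int[leb2]_p (w p * phi p).

Definition weak_derivC_plane (v : R * R) (f g : C -> C) : Prop :=
  weak_deriv_plane v (fun p => complex.Re (f (toC p)))
                     (fun p => complex.Re (g (toC p))) /\
  weak_deriv_plane v (fun p => complex.Im (f (toC p)))
                     (fun p => complex.Im (g (toC p))).

Definition measurable_cfun (g : C -> C) : Prop :=
  measurable_fun setT (fun p : R * R => complex.Re (g (toC p))) /\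
  measurable_fun setT (fun p : R * R => complex.Im (g (toC p))).

Definition L2loc_plane (g : C -> C) : Prop :=
  measurable_cfun g /\
  forall K : set (R * R), compact K ->
    (\int[leb2]_(p in K) (normc (g (toC p)) ^+ 2)%:E < +oo)%E.

(* f is in W^{1,2}_loc, with weak partial derivatives fx and fy. *)
Definition W12loc (f fx fy : C -> C) : Prop :=
  [/\ L2loc_plane f, L2loc_plane fx, L2loc_plane fy,
      weak_derivC_plane (1, 0) f fx & weak_derivC_plane (0, 1) f fy].

(* 0 +i* 1 is written out because 'i parses as the imaginary unit of the abstract
   numClosedFieldType structure. *)
Definition del (fx fy : C -> C) (z : C) : C := (fx z - (0 +i* 1 : C) * fy z) / 2.
Definition delbar (fx fy : C -> C) (z : C) : C := (fx z + (0 +i* 1 : C) * fy z) / 2.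

Definition homeomorphism (f : C -> C) : Prop :=
  continuous f /\
  exists g : C -> C, [/\ continuous g, cancel f g & cancel g f].

Definition cis (t : R) : C := cos t +i* sin t.

(* Local degree +1: as t runs over [0, 2 pi], a continuous argument theta of
   f (z0 + r e^{it}) - f z0 increases by exactly 2 pi. *)
Definition orientation_preserving (f : C -> C) : Prop :=
  forall (z0 : C) (r : R), 0 < r ->
  exists theta : R -> R,
    [/\ continuous theta,
        forall t, f (z0 + r%:C * cis t) - f z0 =
                  (normc (f (z0 + r%:C * cis t) - f z0))%:C * cis (theta t) &
        theta (2 * pi) = theta 0 + 2 * pi].

Definition quasiconformal (rho : C -> C) : Prop :=
  [/\ homeomorphism rho,
      orientation_preserving rho &
      exists rx ry : C -> C,
        W12loc rho rx ry /\
        exists mu : C -> C,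
          [/\ measurable_cfun mu,
              (ess_sup leb2 (fun p => (normc (mu (toC p)))%:E) < 1)%E &
              \forall p \ae leb2,
                delbar rx ry (toC p) = mu (toC p) * del rx ry (toC p)]].

(* rho extended by rho(oo) = oo, read in the chart w = 1/z at oo on both
   sides; derivability is over the field R[i]. *)
Definition chart_at_infinity (rho : C -> C) (w : C) : C :=
  if w == 0 then 0 else (rho w^-1)^-1.

Definition analytic_at_infinity (rho : C -> C) : Prop :=
  \forall w \near (0 : C), derivable (chart_at_infinity rho) w 1.

End Plane.

(* Main.v *)
Require Import Defs.
From HB Require Import structures.
From mathcomp Require Import all_boot all_order all_algebra.
From mathcomp Require Import all_classical all_reals all_analysis.
From mathcomp Require Import measurable_realfun complex zify ring lra.
Set Implicit Arguments.
Unset Strict Implicit.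
Unset Printing Implicit Defensive.
Import Order.TTheory GRing.Theory Num.Theory.
Import numFieldNormedType.Exports.
Import Normc.
Local Open Scope classical_set_scope.
Local Open Scope ring_scope.
Local Open Scope complex_scope.

(** The argument is real-variable: it runs on the continuity of [rho = u + i v],
    its weak partial derivatives and the weighted energy of its d-bar
    derivative, and it is local.

    Recovering [rho] on the real line. By the Cauchy-Pompeiu formula the value of
    a compactly supported function at a real point [a] is, up to a constant, the
    integral of its d-bar derivative against the Cauchy kernel [1 / (z - a)]. To
    localise without spoiling the weight [1 / |y|], [rho] is multiplied by an
    almost analytic cutoff [chi], equal to [1] on a given real interval and with
    d-bar derivative [O(y)]; the d-bar derivative [al] of [rho chi] then still
    has finite [L^2(dm / |y|)] norm ([localised_cauchy_pompeiu]). The formula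
    comes from Green's formula against [chi K], where [K] is the Cauchy kernel
    regularised as [conj (z - a) / (|z - a|^2 + e^2)]: its d-bar derivative is an
    approximate identity at [a] ([cvg_integral_pker]).

    Orthogonality. In [L^2(|y| dm)], the dual of [L^2(dm / |y|)], scaling shows
    that the squared distance between the kernels with poles [a] and [b] is
    [c |a - b|] ([has_integral_energy]). So [a |-> 1 / (z - a)] has the covariance
    of Brownian motion, and its increments over disjoint intervals are orthogonal
    ([has_integral_pole_sum]). The increments of [u] are the products of [al] with
    these orthogonal vectors, and Bessel's inequality bounds
    [\sum (Delta u)^2 / Delta t] over all subdivisions of a bounded interval
    ([dbar_pair_riesz]). Since [- i rho] has the same properties, [v] satisfies
    the same bound ([dbar_pair_rot]).

    Conclusion. This is the condition of F. Riesz for having a derivative in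
    [L^2_loc]. As [2 |Delta u| <= Delta t + (Delta u)^2 / Delta t], it bounds the
    lengths of inscribed polygons ([riesz_rectifiable]). It also says that the
    dyadic difference quotients of [u], a martingale, are bounded in [L^2]; their
    limit is the weak derivative ([riesz_weak_derivative]). *)

(** * Calculus of functions of class C^n *)

Section SmoothCalculus.
Context {R : realType}.
Implicit Types E F : normedModType R.

Lemma is_Cn_continuous {E} n (f : E -> R) : is_Cn n f -> continuous f.
Proof. by case: n => [|n] []. Qed.

Lemma is_CnW {E} n (f : E -> R) : is_Cn n.+1 f -> is_Cn n f.
Proof.
elim: n f => [|n IH] f [cf df]; first by split.
by split=> // v; have [dv cv] := df v; split=> //; apply: IH.
Qed.

Lemma is_Cn_cst {E} n (c : R) : is_Cn n (fun _ : E => c).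
Proof.
elim: n c => [|n IH] c; first by split=> //; exact: cst_continuous.
split; first exact: cst_continuous.
move=> v; split; first by move=> x; exact: derivable_cst.
rewrite (_ : 'D_v _ = fun _ => 0); first exact: IH.
by apply/funext => x; exact: derive_cst.
Qed.

Lemma is_CnD {E} n (f g : E -> R) :
  is_Cn n f -> is_Cn n g -> is_Cn n (fun x => f x + g x).
Proof.
elim: n f g => [|n IH] f g [cf df] [cg dg].
  by split=> // x; apply: cvgD; [exact: cf|exact: cg].
split; first by move=> x; apply: cvgD; [exact: cf|exact: cg].
move=> v; have [fv Dfv] := df v; have [gv Dgv] := dg v.
split; first by move=> x; apply: derivableD.
rewrite (_ : 'D_v _ = fun x => 'D_v f x + 'D_v g x); first exact: IH.
by apply/funext => x; rewrite -deriveD.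
Qed.

Lemma is_CnM {E} n (f g : E -> R) :
  is_Cn n f -> is_Cn n g -> is_Cn n (fun x => f x * g x).
Proof.
elim: n f g => [|n IH] f g Cf Cg; case: (Cf) => cf df; case: (Cg) => cg dg.
  by split=> // x; apply: cvgM; [exact: cf|exact: cg].
split; first by move=> x; apply: cvgM; [exact: cf|exact: cg].
move=> v; have [fv Dfv] := df v; have [gv Dgv] := dg v.
split; first by move=> x; apply: derivableM.
rewrite (_ : 'D_v _ = fun x => f x * 'D_v g x + g x * 'D_v f x).
  by apply: is_CnD; apply: IH => //; exact: is_CnW.
by apply/funext => x; rewrite deriveM.
Qed.

Lemma is_CnN {E} n (f : E -> R) : is_Cn n f -> is_Cn n (fun x => - f x).
Proof.
move=> Cf; rewrite (_ : (fun x => _) = fun x => -1 * f x).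
  by apply: is_CnM => //; exact: is_Cn_cst.
by apply/funext => x; rewrite mulN1r.
Qed.

Lemma is_CnV {E} n (f : E -> R) : (forall x, f x != 0) ->
  is_Cn n f -> is_Cn n (fun x => (f x)^-1).
Proof.
move=> f0; elim: n => [|n IH] Cf; case: (Cf) => cf df.
  by split=> // x; apply: cvgV => //; exact: cf.
split; first by move=> x; apply: cvgV => //; exact: cf.
move=> v; have [fv Dfv] := df v.
split; first by move=> x; apply: derivableV.
rewrite (_ : 'D_v _ = fun x => - ((f x)^-1 * (f x)^-1 * 'D_v f x)).
  have Vn := IH (is_CnW Cf).
  by apply/is_CnN/is_CnM => //; exact: is_CnM.
by apply/funext => x; rewrite deriveV// -exprVn expr2 scaleNr.
Qed.

(** Difference quotients commute with precomposition by an affine map [A] of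
    linear part [L], so no chain rule is involved. *)
Lemma is_Cn_affine {E F} n (A L : E -> F) (f : F -> R) : continuous A ->
  (forall h v x, A (h *: v + x) = h *: L v + A x) ->
  is_Cn n f -> is_Cn n (fun x => f (A x)).
Proof.
move=> cA AL; elim: n f => [|n IH] f [cf df].
  by split=> // x; apply: continuous_comp; [exact: cA|exact: cf].
split; first by move=> x; apply: continuous_comp; [exact: cA|exact: cf].
have Dq v x : (fun h : R => h^-1 *: (f (A (h *: v + x)) - f (A x))) =
    (fun h => h^-1 *: (f (h *: L v + A x) - f (A x))).
  by apply/funext => h; rewrite AL.
move=> v; have [fv Dfv] := df (L v); split.
  by move=> x; rewrite /derivable/= Dq; exact: fv.
rewrite (_ : 'D_v (fun x => f (A x)) = fun x => 'D_(L v) f (A x)).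
  exact: (IH ('D_(L v) f)).
by apply/funext => x; rewrite /derive/= Dq.
Qed.

(** On the line the direction [1] controls all the others. *)
Lemma is_Cn_line n (f : R -> R) : continuous f ->
  (forall x, derivable f x 1) -> is_Cn n ('D_1 f) -> is_Cn n.+1 f.
Proof.
move=> cf df Cf; split => // v.
have E x : differentiable f x by apply/derivable1_diffP.
split; first by move=> x; apply: diff_derivable.
rewrite (_ : 'D_v f = fun x => v * 'D_1 f x).
  by apply: is_CnM => //; exact: is_Cn_cst.
by apply/funext => x; rewrite !deriveE// -{1}[v]mulr1 -[v * 1]/(v *: 1) linearZ.
Qed.

End SmoothCalculus.

(** * Smooth cutoff functions on the line *)

Section Cutoff.
Context {R : realType}.

Definition smooth {E : normedModType R} (f : E -> R) := forall n, is_Cn n f.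

(** The family is closed, up to linear combinations, under differentiation;
    its members vanish to infinite order at [0]. *)
Definition flat (n : nat) (x : R) : R :=
  if 0 < x then x^-1 ^+ n * expR (- x^-1) else 0.

Lemma flat_le0 n x : x <= 0 -> flat n x = 0.
Proof. by rewrite /flat leNgt => /negbTE ->. Qed.

Lemma flat_gt0 n x : 0 < x -> 0 < flat n x.
Proof. by move=> x0; rewrite /flat x0 mulr_gt0 ?expR_gt0// exprn_gt0// invr_gt0. Qed.

Lemma flat_ge0 n x : 0 <= flat n x.
Proof. by have [/flat_le0->//|/(flat_gt0 n)/ltW] := leP x 0. Qed.

Lemma flat_le n x : flat n x <= (n.+1)`!%:R * `|x|.
Proof.
have [x0|x0] := leP x 0; first by rewrite flat_le0// mulr_ge0.
rewrite /flat x0 gtr0_norm// expRN.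
set t := x^-1; have t0 : 0 < t by rewrite invr_gt0.
have -> : x = t^-1 by rewrite invrK.
rewrite ler_pdivrMr ?expR_gt0// -ler_pdivrMl ?divr_gt0 ?ltr0n ?fact_gt0//.
rewrite invfM invrK -mulrA -exprS mulrC.
by apply: le_trans (expR_ge1Dxn n (ltW t0)); rewrite lerDr.
Qed.

(** Away from [0] this is the product rule; at [0] the difference quotient of
    [flat n] is [flat n.+1], which [flat_le] squeezes to [0]. *)
Lemma is_derive_flat n (x : R) :
  is_derive x 1 (flat n) (flat n.+2 x - n%:R * flat n.+1 x).
Proof.
have [x0|x0|->] := ltgtP x 0.
- rewrite !flat_le0 ?ltW// mulr0 subr0.
  apply: (@near_eq_is_derive _ _ _ (cst 0)).
  near=> y; rewrite flat_le0//; apply/ltW; near: y; exact: lt_nbhsl.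
- have xn0 : x != 0 by rewrite gt_eqF.
  have H1 : is_derive x 1 (fun y : R => y^-1) (- x ^- 2).
    have := @is_deriveV R id x 1 1 xn0 (is_derive_id _ _).
    by rewrite /GRing.scale/= mulr1.
  have H2 : is_derive x 1 (fun y : R => - y^-1) (x ^- 2).
    by rewrite -[x ^- 2]opprK; exact: is_deriveN.
  have H3 : is_derive x 1 (expR \o (fun y : R => - y^-1))
      (expR (- x^-1) * x ^- 2).
    exact: is_derive1_comp.
  have H4 := @is_deriveX R R (fun y : R => y^-1) n x 1 _ H1.
  have [H5 H6] := @is_deriveM R R _ _ x 1 _ _ H4 H3.
  have H7 : \near x, ((fun y : R => y^-1) ^+ n * (expR \o (fun y : R => - y^-1))) x
      = flat n x.
    near=> y; rewrite /flat ifT; first by rewrite mulrfctE exprfctE.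
    by near: y; exact: lt_nbhsr.
  apply: (near_eq_is_derive H7); split=> //; rewrite H6.
  rewrite /flat x0 exprfctE /GRing.scale/= !exprS exprVn.
  case: n {H4 H5 H6 H7} => [|n]; first by rewrite !mul0r !expr0; field.
  rewrite [n.+1.-1]/= !exprS expr0 exprVn.
  have : x ^+ n != 0 by rewrite expf_neq0.
  by move: (x ^+ n) => z z0; field; rewrite xn0 z0.
- have q h : h^-1 *: ((flat n \o shift 0) (h *: 1) - flat n 0) = flat n.+1 h.
    rewrite /= addr0 [h *: 1]mulr1 (flat_le0 n (lexx 0)) subr0.
    rewrite /flat; case: ifP => h0; last by rewrite scaler0.
    by rewrite -[_ *: _]/(_ * _) exprS mulrA.
  have c : (fun h => h^-1 *: ((flat n \o shift 0) (h *: 1) - flat n 0)) @ 0^' --> (0:R).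
    under eq_fun do rewrite q.
    apply: (@squeeze_cvgr _ _ _ _ (cst 0) (fun h => (n.+2)`!%:R * `|h|)).
    - by near=> h; rewrite flat_ge0 flat_le.
    - exact: cvg_cst.
    - rewrite -[X in _ --> X](mulr0 (n.+2)`!%:R) -[X in _ * X](@normr0 _ R).
      apply: cvgM; [exact: cvg_cst|apply: cvg_norm; exact: nbhs_dnbhs].
  rewrite !(flat_le0 _ (lexx 0)) mulr0 subr0; split; first exact: cvgP c.
  exact/cvg_lim.
Unshelve. all: by end_near. Qed.

Lemma smooth_flat n : smooth (flat n).
Proof.
move=> m; elim: m n => [|m IH] n.
  split=> // x; apply: differentiable_continuous; apply/derivable1_diffP.
  by have [] := is_derive_flat n x.
apply: is_Cn_line.
- move=> x; apply: differentiable_continuous; apply/derivable1_diffP.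
  by have [] := is_derive_flat n x.
- by move=> x; have [] := is_derive_flat n x.
- rewrite (_ : 'D_1 (flat n) = fun x => flat n.+2 x + - (n%:R * flat n.+1 x)).
    by apply: is_CnD => //; apply/is_CnN/is_CnM => //; exact: is_Cn_cst.
  by apply/funext => x; have [_ ->] := is_derive_flat n x.
Qed.

Definition smooth_step (x : R) : R := flat 0 x / (flat 0 x + flat 0 (1 - x)).

Lemma smooth_step_den_gt0 x : 0 < flat 0 x + flat 0 (1 - x).
Proof.
have [x0|x0] := ltP 0 x; first by rewrite ltr_pwDl ?flat_gt0 ?flat_ge0.
by rewrite ltr_wpDl ?flat_ge0 ?flat_gt0//; lra.
Qed.

Lemma smooth_smooth_step : smooth smooth_step.
Proof.
move=> n; apply: is_CnM; first exact: smooth_flat.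
apply: is_CnV => [x|]; first by rewrite gt_eqF// smooth_step_den_gt0.
apply: is_CnD; first exact: smooth_flat.
apply: (@is_Cn_affine _ _ _ _ (fun x : R => 1 - x) -%R (flat 0)).
- by move=> x; apply: cvgB; [exact: cvg_cst|exact: cvg_id].
- by move=> h v x; rewrite scalerN opprD addrCA addrA.
- exact: smooth_flat.
Qed.

Lemma smooth_step_ge1 x : 1 <= x -> smooth_step x = 1.
Proof.
move=> x1; rewrite /smooth_step (@flat_le0 _ (1 - x)) ?subr_le0// addr0 divff//.
by rewrite gt_eqF// flat_gt0// (lt_le_trans ltr01).
Qed.

Lemma smooth_step_le0 x : x <= 0 -> smooth_step x = 0.
Proof. by move=> x0; rewrite /smooth_step flat_le0// mul0r. Qed.

Definition cutoff (N : R) (x : R) : R :=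
  smooth_step (x + (N + 1)) * smooth_step (- x + (N + 1)).

Lemma smooth_cutoff N : smooth (cutoff N).
Proof.
move=> n; apply: is_CnM.
  apply: (@is_Cn_affine _ _ _ _ (fun x : R => x + (N + 1)) id smooth_step).
  - by move=> x; apply: cvgD; [exact: cvg_id|exact: cvg_cst].
  - by move=> h v x; rewrite -addrA.
  - exact: smooth_smooth_step.
apply: (@is_Cn_affine _ _ _ _ (fun x : R => - x + (N + 1)) -%R smooth_step).
- by move=> x; apply: cvgD; [exact: opp_continuous|exact: cvg_cst].
- by move=> h v x; rewrite opprD scalerN -addrA.
- exact: smooth_smooth_step.
Qed.

Lemma cutoff_eq1 N x : `|x| <= N -> cutoff N x = 1.
Proof. by rewrite ler_norml => xN; rewrite /cutoff !smooth_step_ge1 ?mulr1//; lra. Qed.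

Lemma cutoff_eq0 N x : N + 1 <= `|x| -> cutoff N x = 0.
Proof.
rewrite ler_normr => /orP[xN|xN]; rewrite /cutoff.
  by rewrite (@smooth_step_le0 (- x + _)) ?mulr0//; lra.
by rewrite smooth_step_le0 ?mul0r//; lra.
Qed.

Lemma smooth_D1 (f : R -> R) : smooth f -> smooth ('D_1 f).
Proof. by move=> sf n; have [_ /(_ 1)[]] := sf n.+1. Qed.

Lemma smooth_derivable {E : normedModType R} (f : E -> R) v x :
  smooth f -> derivable f x v.
Proof. by move=> sf; have [_ /(_ v)[]] := sf 1%N. Qed.

Lemma smooth_continuous {E : normedModType R} (f : E -> R) :
  smooth f -> continuous f.
Proof. by move=> /(_ 0%N)/is_Cn_continuous. Qed.

Lemma derive1_near_cst (f : R -> R) x c : (\near x, f x = c) -> 'D_1 f x = 0.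
Proof. by move=> fc; rewrite (near_eq_derive (g := cst c))// derive_cst. Qed.

Lemma derive_eq0_beyond (f : R -> R) M : (forall x, M < `|x| -> f x = 0) ->
  forall x, M < `|x| -> 'D_1 f x = 0.
Proof.
move=> f0 x Mx; apply: (@derive1_near_cst _ _ 0).
near=> y; apply: f0; near: y.
have := @norm_continuous _ R x.
by move=> /cvgr_gt; apply.
Unshelve. all: by end_near. Qed.

Lemma cutoff_derive_eq0 N x : `|x| < N -> 'D_1 (cutoff N) x = 0.
Proof.
move=> xN; apply: (@derive1_near_cst _ _ 1).
near=> y; apply/cutoff_eq1/ltW; near: y.
have := @norm_continuous _ R x.
by move=> /cvgr_lt; apply.
Unshelve. all: by end_near. Qed.

Lemma continuous_supp_bounded (f : R -> R) M : continuous f ->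
  (forall x, M < `|x| -> f x = 0) -> exists2 C, 0 <= C & forall x, `|f x| <= C.
Proof.
move=> cf f0.
have cM : {within `[- M, M], continuous f} by exact: continuous_subspaceT.
have [|] := boolP (0 <= M) => M0; last first.
  by exists 0 => // x; rewrite f0 ?normr0//; apply: lt_le_trans (normr_ge0 _); rewrite ltNge.
have [c cM1 cmax] : exists2 c, c \in `[- M, M] & forall t, t \in `[- M, M] -> `|f t| <= `|f c|.
  apply: (@EVT_max _ (fun x => `|f x|)); first by lra.
  by apply: continuous_subspaceT => x; apply: cvg_norm; exact: cf.
exists `|f c| => // x.
have [xM|/f0->] := leP `|x| M; last by rewrite normr0.
by apply: cmax; rewrite in_itv/= -ler_norml.
Qed.

End Cutoff.

(** * Changes of variables *)

Section AffineChange.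
Context {R : realType}.
Local Notation leb := (@lebesgue_measure R).
Local Open Scope ereal_scope.

(** The push-forward of Lebesgue measure by [x |-> s * x + a], multiplied by [s],
    gives every interval its length, hence is Lebesgue measure by uniqueness. *)
Lemma ge0_integral_affine (s a : R) (f : R -> \bar R) : (0 < s)%R ->
  measurable_fun [set: R] f -> (forall x, 0 <= f x) ->
  s%:E * \int[leb]_x f (s * x + a)%R = \int[leb]_x f x.
Proof.
move=> s0 mf f0.
pose T (x : measurableTypeR R) : measurableTypeR R := (s * x + a)%R.
have mT : measurable_fun setT T.
  by apply: measurable_funD; [exact: measurable_funM|exact: measurable_cst].
pose sn : {nonneg R} := NngNum (ltW s0).
pose m0 : {measure set (measurableTypeR R) -> \bar R} :=
  mscale sn (pushforward leb T).
pose m := m0 mT.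
have lebE A : measurable A -> leb A = m A.
  apply: lebesgue_measure_unique => /= _ [[p q]] _ <-.
  rewrite /m /m0 /mscale/= /pushforward.
  have -> : T @^-1` `]p, q] = `]((p - a) / s)%R, ((q - a) / s)%R]%classic.
    apply/seteqP; split => x /=; rewrite !in_itv/= /T.
      by move=> /andP[px xq]; rewrite ltr_pdivrMr// ler_pdivlMr//; lra.
    by rewrite ltr_pdivrMr// ler_pdivlMr// => /andP[px xq]; lra.
  rewrite !lebesgue_measure_itv/= !lte_fin ltr_pM2r ?invr_gt0// ltrD2r.
  case: ifP => pq; last by rewrite mule0.
  rewrite -!EFinB -EFinM; congr EFin; field; lra.
rewrite [RHS](@eq_measure_integral _ _ _ _ m); last first.
  by move=> A mA _; exact: lebE.
by rewrite ge0_integral_mscale//= ge0_integral_pushforward.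
Qed.

Local Notation leb2 := (lebesgue2 R).

Lemma ge0_integral_affine2 (s a : R) (f : R * R -> \bar R) : (0 < s)%R ->
  measurable_fun [set: R * R] f -> (forall p, 0 <= f p) ->
  (s ^+ 2)%:E * \int[leb2]_p f (s * p.1 + a, s * p.2)%R = \int[leb2]_p f p.
Proof.
move=> s0 mf f0.
have mT : measurable_fun setT (fun p : R * R => (s * p.1 + a, s * p.2)%R).
  apply/measurable_fun_pair => /=.
    by apply: measurable_funD => //; exact: measurable_funM.
  exact: measurable_funM.
have mfT := measurableT_comp mf mT.
rewrite fubini_tonelli1//= [RHS]fubini_tonelli1//= /fubini_F/=.
rewrite -(@ge0_integral_affine s a (fun x => \int[leb]_y f (x, y)))//; last 2 first.
- exact: (@measurable_fun_fubini_tonelli_F _ _ _ _ R leb f).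
- by move=> x; exact: integral_ge0.
rewrite expr2 EFinM -muleA; congr (_ * _).
rewrite -ge0_integralZl_EFin//; last 3 first.
- by move=> x _; exact: integral_ge0.
- exact: (@measurable_fun_fubini_tonelli_F _ _ _ _ R leb _ mfT (fun p => f0 _)).
- exact: ltW.
apply: eq_integral => x _.
rewrite -[RHS](@ge0_integral_affine s 0 (fun y => f ((s * x + a)%R, y)))//; last first.
  by apply: measurableT_comp => //.
by congr (_ * _); apply: eq_integral => y _; rewrite addr0.
Qed.

End AffineChange.

(** * Measurability of rational expressions, and an integrable density *)

Section Measurability.
Context {R : realType}.

Lemma measurable_funV d (T : measurableType d) (D : set T) (f : T -> R) :
  measurable_fun D f -> measurable_fun D (fun x => (f x)^-1).
Proof.
move=> mf.
(* The square makes the base of the real power nonnegative; where [f x = 0]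
   both sides are [0]. *)
rewrite (_ : (fun x => _) = fun x => f x * (f x ^+ 2) `^ (-1)); last first.
  apply/funext => x; rewrite powR_inv1 ?sqr_ge0// expr2 invfM mulrA.
  by have [->|f0] := eqVneq (f x) 0; rewrite ?invr0 ?mulr0// divff// mul1r.
apply: measurable_funM => //.
apply: (measurableT_comp (measurable_powR (-1))).
exact: measurable_funX.
Qed.

End Measurability.

(** Reduces the measurability of an arithmetic expression to that of its
    atoms. *)
Ltac measurable_arith := repeat match goal with
  | H : ?P |- ?P => exact: H
  | |- measurable_fun _ fst => exact: measurable_fst
  | |- measurable_fun _ ( *%R ?c) => exact: mulrl_measurable
  | |- measurable_fun _ GRing.inv => apply: (measurable_funV (f := id))
  | |- measurable_fun _ snd => exact: measurable_snd
  | |- measurable_fun _ (fun x => (@?f x + @?g x)%R) => apply: measurable_funD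
  | |- measurable_fun _ (fun x => (@?f x + @?g x)%E) => apply: emeasurable_funD
  | |- measurable_fun _ (fun x => (@?f x * @?g x)%E) => apply: emeasurable_funM
  | |- measurable_fun _ (fun x => (- @?f x)%R) => apply: measurable_funN
  | |- measurable_fun _ (fun x => (@?f x * @?g x)%R) => apply: measurable_funM
  | |- measurable_fun _ (fun x => (@?f x)^-1%R) => apply: measurable_funV
  | |- measurable_fun _ (fun x => (@?f x ^+ ?n)%R) => apply: measurable_funX
  | |- measurable_fun _ (fun x => `|@?f x|%R) =>
      apply: (measurableT_comp (@normr_measurable _ _))
  | |- measurable_fun _ (fun x => (@?f x)%:E) => apply/measurable_EFinP
  | |- measurable_fun _ id => exact: measurable_id
  | |- measurable_fun _ (fun x => x) => exact: measurable_id
  | H : measurable_fun _ _ |- measurable_fun _ _ => exact: H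
  | |- measurable_fun _ (fun x => ?c) => exact: measurable_cst
  end.

Section Kernels.
Context {R : realType}.
Local Notation leb := (@lebesgue_measure R).
Local Notation leb2 := (lebesgue2 R).

Lemma integral_inv_oneDsqr :
  (\int[leb]_x ((1 + x ^+ 2)^-1)%:E = (pi : R)%:E)%E.
Proof.
rewrite (@ge0_symfun_integralT _ (fun x => (1 + x ^+ 2)^-1)).
- have := @integral0y_oneDsqr R; rewrite set_itvcy => ->.
  by rewrite -EFinM; congr EFin; field.
- by move=> x; rewrite invr_ge0 addr_ge0// sqr_ge0.
- exact: continuous_oneDsqrV.
- by move=> x /=; rewrite sqrrN.
Qed.

(** The Poisson kernel of the half-plane has mass [pi], whatever the height. *)
Lemma integral_abs_div (y : R) : y != 0 ->
  (\int[leb]_x (`|y| / (x ^+ 2 + y ^+ 2))%:E = (pi : R)%:E)%E.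
Proof.
move=> y0; have ny0 : 0 < `|y| by rewrite normr_gt0.
rewrite -(@ge0_integral_affine _ `|y| 0)//; last 2 first.
- measurable_arith.
- by move=> x; rewrite lee_fin divr_ge0 ?addr_ge0 ?sqr_ge0.
rewrite -integral_inv_oneDsqr -ge0_integralZl_EFin//; last 2 first.
- by move=> x _; rewrite lee_fin divr_ge0 ?addr_ge0 ?sqr_ge0.
- measurable_arith.
apply: eq_integral => x _; rewrite -EFinM; congr EFin.
rewrite addr0 exprMn -[in y ^+ 2]real_normK ?num_real//.
have : 1 + x ^+ 2 != 0 by rewrite gt_eqF// ltr_wpDr ?sqr_ge0.
have : `|y| ^+ 2 * x ^+ 2 + `|y| ^+ 2 != 0.
  by rewrite gt_eqF// ltr_wpDl ?exprn_gt0// mulr_ge0 ?sqr_ge0.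
by move: ny0; move: `|y| => n n0 nx x1; field; rewrite x1 exprMn nx.
Qed.

(** The measure with this density is finite; it dominates [|y| / |z|^2] on
    bounded sets. *)
Definition dens (a : R) (p : R * R) : R :=
  `|p.2| / (((p.1 - a) ^+ 2 + p.2 ^+ 2) * (1 + ((p.1 - a) ^+ 2 + p.2 ^+ 2))).

Lemma dens_ge0 a p : 0 <= dens a p.
Proof. by rewrite divr_ge0// mulr_ge0// ?addr_ge0 ?sqr_ge0. Qed.

Lemma measurable_dens a : measurable_fun setT (dens a).
Proof. rewrite /dens; measurable_arith. Qed.

Lemma integral_dens a :
  (\int[leb2]_p (dens a p)%:E = \int[leb2]_p (dens 0 p)%:E)%E.
Proof.
rewrite -(@ge0_integral_affine2 _ 1 a (fun p => (dens a p)%:E))//.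
- rewrite expr1n mul1e; apply: eq_integral => p _.
  by rewrite /dens/= !mul1r subr0 addrK.
- by apply/measurable_EFinP; exact: measurable_dens.
- by move=> p; rewrite lee_fin dens_ge0.
Qed.

(** For fixed [y] the density is at most [1 / (1 + y ^ 2)] times the Poisson
    kernel of height [y]. *)
Lemma integral_dens_lty a : (\int[leb2]_p (dens a p)%:E < +oo)%E.
Proof.
rewrite integral_dens.
have mD : measurable_fun [set: R * R] (fun p => (dens 0 p)%:E).
  by apply/measurable_EFinP; exact: measurable_dens.
have D0 p : (0 <= (dens 0 p)%:E)%E by rewrite lee_fin dens_ge0.
rewrite fubini_tonelli2//.
apply: (@le_lt_trans _ _ (\int[leb]_y ((pi * (1 + y ^+ 2)^-1)%:E))%E).
  apply: ge0_le_integral => //.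
  - by move=> y _; exact: integral_ge0.
  - exact: (@measurable_fun_fubini_tonelli_G _ _ _ _ R leb _ mD D0).
  - measurable_arith.
  move=> y _; have [->|y0] := eqVneq y 0.
    rewrite [X in (X <= _)%E]integral0_eq.
      by rewrite lee_fin mulr_ge0 ?pi_ge0// invr_ge0 addr_ge0 ?sqr_ge0.
    by move=> x _; rewrite /dens/= normr0 mul0r.
  rewrite EFinM -(integral_abs_div y0) -ge0_integralZr//; last 3 first.
  - measurable_arith.
  - by move=> x _; rewrite lee_fin divr_ge0 ?addr_ge0 ?sqr_ge0.
  - by rewrite lee_fin invr_ge0 addr_ge0 ?sqr_ge0.
  apply: ge0_le_integral => //.
  - rewrite /dens/=; measurable_arith.
  - measurable_arith.
  move=> x _; rewrite -EFinM lee_fin /dens/= subr0 invfM mulrA.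
  have y20 : 0 < y ^+ 2 by rewrite exprn_even_gt0.
  rewrite ler_wpM2l// ?divr_ge0 ?addr_ge0 ?sqr_ge0//.
  rewrite lef_pV2 ?posrE; last 2 first.
  - by have := sqr_ge0 x; lra.
  - by lra.
  by have := sqr_ge0 x; lra.
under eq_integral do rewrite EFinM.
rewrite ge0_integralZl_EFin ?pi_ge0//; last 2 first.
- by move=> y _; rewrite lee_fin invr_ge0 addr_ge0 ?sqr_ge0.
- measurable_arith.
by rewrite integral_inv_oneDsqr -EFinM ltry.
Qed.

End Kernels.

(** * The Cauchy kernels as a curve in L^2(|y| dm) *)

Section HasIntegral.
Context d (T : measurableType d) (R : realType).
Context (mu : {measure set T -> \bar R}).

(** Bundling integrability with the value lets one compose linear combinations of
    integrals without discharging integrability side conditions each time. *)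
Definition has_integral (f : T -> R) (v : R) : Prop :=
  mu.-integrable setT (EFin \o f) /\ \int[mu]_x f x = v.

Lemma has_integral_Rintegral f :
  mu.-integrable setT (EFin \o f) -> has_integral f (\int[mu]_x f x).
Proof. by []. Qed.

Lemma has_integral_ge0 (f : T -> R) v : measurable_fun setT f -> (forall x, 0 <= f x) ->
  (\int[mu]_x (f x)%:E = v%:E)%E -> has_integral f v.
Proof.
move=> mf f0 fv; split; last by rewrite /Rintegral fv.
apply/integrableP; split; first exact/measurable_EFinP.
by under eq_integral do rewrite gee0_abs ?lee_fin//; rewrite fv ltry.
Qed.

Lemma integrable_ge0 (f : T -> R) : measurable_fun setT f ->
  (forall x, 0 <= f x) -> (\int[mu]_x (f x)%:E < +oo)%E ->
  mu.-integrable setT (EFin \o f).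
Proof.
move=> mf f0 foo; apply/integrableP; split; first exact/measurable_EFinP.
by under eq_integral do rewrite gee0_abs ?lee_fin//.
Qed.

Lemma eq_has_integral f g v : f =1 g -> has_integral f v -> has_integral g v.
Proof. by move=> /funext ->. Qed.

Lemma has_integralD f g v w : has_integral f v -> has_integral g w ->
  has_integral (fun x => f x + g x) (v + w).
Proof.
move=> [f1 <-] [g1 <-]; split; last by rewrite RintegralD.
by rewrite (_ : EFin \o _ = (EFin \o f) \+ (EFin \o g))%E//; exact: integrableD.
Qed.

Lemma has_integralZ k f v : has_integral f v -> has_integral (fun x => k * f x) (k * v).
Proof.
move=> [f1 <-]; split; last by rewrite RintegralZl.
rewrite (_ : EFin \o _ = (fun x => k%:E * (EFin \o f) x)%E)//.
exact: integrableZl.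
Qed.

Lemma has_integralN f v : has_integral f v -> has_integral (fun x => - f x) (- v).
Proof.
move=> /(has_integralZ (-1)); rewrite mulN1r.
by apply: eq_has_integral => x; rewrite mulN1r.
Qed.

Lemma has_integral0 : has_integral (fun=> 0) 0.
Proof.
split; first exact: integrable0.
by rewrite /Rintegral integral0.
Qed.

Lemma has_integral_sum n (f : nat -> T -> R) (v : nat -> R) :
  (forall k, (k < n)%N -> has_integral (f k) (v k)) ->
  has_integral (fun x => \sum_(k < n) f k x) (\sum_(k < n) v k).
Proof.
elim: n => [|n IH] fv.
  rewrite big_ord0; apply: eq_has_integral has_integral0 => x.
  by rewrite big_ord0.
rewrite big_ord_recr/=.
apply: (@eq_has_integral (fun x => \sum_(k < n) f k x + f n x)).
  by move=> x; rewrite big_ord_recr.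
apply: has_integralD; last exact: fv.
by apply: IH => k kn; apply: fv; exact: ltnW.
Qed.

Lemma has_integral_le f g v w : has_integral f v -> has_integral g w ->
  (forall x, f x <= g x) -> v <= w.
Proof. by move=> [f1 <-] [g1 <-] fg; exact: le_Rintegral. Qed.

End HasIntegral.

Section CauchyKernel.
Context {R : realType}.
Local Notation leb := (@lebesgue_measure R).
Local Notation leb2 := (lebesgue2 R).

(** Real and imaginary part of [conj (z - a) / (|z - a|^2 + e^2)], which is
    the Cauchy kernel [1 / (z - a)] when [e = 0]. *)
Definition kden (e a : R) (p : R * R) : R := (p.1 - a) ^+ 2 + p.2 ^+ 2 + e ^+ 2.
Definition kre (e a : R) (p : R * R) : R := (p.1 - a) / kden e a p.
Definition kim (e a : R) (p : R * R) : R := - p.2 / kden e a p.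

(** [|y| |1 / (z - a) - 1 / (z - b)|^2]. *)
Definition energy (a b : R) (p : R * R) : R := `|p.2| *
  ((kre 0 a p - kre 0 b p) ^+ 2 + (kim 0 a p - kim 0 b p) ^+ 2).

Lemma measurable_kre e a : measurable_fun setT (kre e a).
Proof. rewrite /kre /kden; measurable_arith. Qed.

Lemma measurable_kim e a : measurable_fun setT (kim e a).
Proof. rewrite /kim /kden; measurable_arith. Qed.

Lemma measurable_energy a b : measurable_fun setT (energy a b).
Proof.
rewrite /energy; have := measurable_kre 0; have := measurable_kim 0 => k1 k2.
have := k1 a; have := k1 b; have := k2 a; have := k2 b => {}k1 {}k2 ? ?.
measurable_arith.
Qed.

Lemma energy_ge0 a b p : 0 <= energy a b p.
Proof. by rewrite mulr_ge0// addr_ge0 ?sqr_ge0. Qed.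

Lemma kden_gt0 e a p : p.2 != 0 -> 0 < kden e a p.
Proof.
move=> y0; rewrite ltr_wpDr ?sqr_ge0// ltr_wpDl ?sqr_ge0//.
by rewrite exprn_even_gt0.
Qed.

Lemma energyE a b p :
  energy a b p = `|p.2| * (a - b) ^+ 2 / (kden 0 a p * kden 0 b p).
Proof.
rewrite /energy; have [->|y0] := eqVneq p.2 0; first by rewrite normr0 !mul0r.
rewrite -mulrA; congr (_ * _); rewrite /kre /kim.
have := kden_gt0 0 a y0; have := kden_gt0 0 b y0.
rewrite /kden !expr0n/= !addr0 => Da Db.
by field; rewrite !gt_eqF.
Qed.

Lemma energyC a b p : energy a b p = energy b a p.
Proof. by rewrite !energyE -opprB sqrrN [kden 0 a p * _]mulrC. Qed.

(** Scaling [z = s w + a] with [s = b - a] multiplies [|y| dm] by [s ^ 3] and the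
    squared difference of kernels by [s ^ - 2]. *)
Lemma integral_energy a b : a < b ->
  (\int[leb2]_p (energy a b p)%:E =
   (b - a)%:E * \int[leb2]_p (energy 0 1 p)%:E)%E.
Proof.
move=> ab; have s0 : 0 < b - a by rewrite subr_gt0.
rewrite -(@ge0_integral_affine2 _ (b - a) a (fun p => (energy a b p)%:E))//; last 2 first.
- by apply/measurable_EFinP; exact: measurable_energy.
- by move=> p; rewrite lee_fin energy_ge0.
set s := b - a in s0 *.
rewrite expr2 EFinM -muleA; congr (_ * _)%E.
rewrite -ge0_integralZl_EFin ?ltW//; last 2 first.
- by move=> p _; rewrite lee_fin energy_ge0.
- apply/measurable_EFinP.
  apply: (measurableT_comp (measurable_energy a b)).
  apply/measurable_fun_pair => /=; measurable_arith.
apply: eq_integral => p _; rewrite -EFinM; congr EFin.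
rewrite !energyE/= normrM gtr0_norm//.
have [->|y0] := eqVneq p.2 0; first by rewrite normr0 !(mulr0, mul0r).
have := kden_gt0 0 0 y0; have := kden_gt0 0 1 y0.
have -> : kden 0 a (s * p.1 + a, s * p.2) = s ^+ 2 * kden 0 0 p.
  by rewrite /kden/=; ring.
have -> : kden 0 b (s * p.1 + a, s * p.2) = s ^+ 2 * kden 0 1 p.
  by rewrite /kden/= /s; ring.
have -> : (a - b) ^+ 2 = s ^+ 2 by rewrite -opprB sqrrN.
move: (kden 0 0 p) (kden 0 1 p) => A B B0 A0.
by field; rewrite !gt_eqF.
Qed.

(** The squared distances [A] and [B] to the two poles satisfy [A + B >= 1/2], so
    [1 / (A B) = (1 / A + 1 / B) / (A + B)] has its two singularities separated. *)
Lemma energy01_le p : energy 0 1 p <= 3 * (dens 0 p + dens 1 p).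
Proof.
rewrite energyE /dens.
have [->|y0] := eqVneq p.2 0.
  by rewrite normr0 !mul0r addr0 mulr0.
have := kden_gt0 0 0 y0; have := kden_gt0 0 1 y0.
rewrite /kden !expr0n/= !addr0 sub0r sqrrN expr1n mulr1.
set A := _ + _ => A0; set B := (p.1 - 0) ^+ 2 + _ => B0.
rewrite -mulrDr [3 * _]mulrCA ler_wpM2l//.
have AB : A + B = 2 * p.1 ^+ 2 - 2 * p.1 + 1 + 2 * p.2 ^+ 2 by rewrite /A /B; ring.
have y2 := sqr_ge0 p.2.
have HB : (1 + B) / 3 <= A + B.
  rewrite AB /B; have : 0 <= (p.1 * 5 - 3) ^+ 2 by exact: sqr_ge0.
  by nra.
have HA : (1 + A) / 3 <= A + B.
  rewrite AB /A; have : 0 <= (p.1 * 5 - 2) ^+ 2 by exact: sqr_ge0.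
  by nra.
have AB0 : 0 < A + B by lra.
have inv_le C : 0 < C -> (1 + C) / 3 <= A + B -> (A + B)^-1 <= 3 / (1 + C).
  move=> C0 HC; have C1 : 0 < (1 + C) / 3 by rewrite divr_gt0//; lra.
  by rewrite -[3 / _]invf_div lef_pV2 ?posrE//; lra.
have -> : (B * A)^-1 = (A + B)^-1 * B^-1 + (A + B)^-1 * A^-1.
  by field; rewrite !gt_eqF.
have -> : 3 * ((B * (1 + B))^-1 + (A * (1 + A))^-1) =
    3 / (1 + B) * B^-1 + 3 / (1 + A) * A^-1.
  by field; rewrite !gt_eqF// ltr_wpDl.
by apply: lerD; apply: ler_wpM2r; rewrite ?invr_ge0; first [exact: ltW|exact: inv_le].
Qed.

Lemma integral_energy01_lty : (\int[leb2]_p (energy 0 1 p)%:E < +oo)%E.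
Proof.
have md := @measurable_dens R.
apply: (@le_lt_trans _ _ (\int[leb2]_p ((3 * (dens 0 p + dens 1 p))%:E))%E).
  apply: ge0_le_integral => //.
  - by move=> p _; rewrite lee_fin energy_ge0.
  - by apply/measurable_EFinP; exact: measurable_energy.
  - have := md 0; have := md 1 => ? ?; measurable_arith.
  - by move=> p _; rewrite lee_fin energy01_le.
under eq_integral do rewrite EFinM.
rewrite ge0_integralZl_EFin//; last 2 first.
- by move=> p _; rewrite lee_fin addr_ge0// dens_ge0.
- by apply/measurable_EFinP; apply: measurable_funD; exact: md.
under eq_integral do rewrite EFinD.
rewrite ge0_integralD//; last 4 first.
- by move=> p _; rewrite lee_fin dens_ge0.
- by apply/measurable_EFinP; exact: md.
- by move=> p _; rewrite lee_fin dens_ge0.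
- by apply/measurable_EFinP; exact: md.
by rewrite lte_mul_pinfty// ?lee_fin// lte_add_pinfty// integral_dens_lty.
Qed.

Definition energy_cst : R := \int[leb2]_p energy 0 1 p.

(** As [a] varies, the Cauchy kernels [1 / (z - a)] form a Brownian-like curve in
    [L^2(|y| dm)]: by homogeneity the squared distance of two of them is
    proportional to the distance of their poles. *)
Lemma has_integral_energy a b :
  has_integral leb2 (energy a b) (energy_cst * `|a - b|).
Proof.
wlog ab : a b / a <= b.
  move=> W; have [/W//|/ltW/W] := leP a b.
  by rewrite distrC; apply: eq_has_integral => p; exact: energyC.
apply: has_integral_ge0.
- exact: measurable_energy.
- exact: energy_ge0.
move: ab; rewrite le_eqVlt => /predU1P[->|ab].
  rewrite subrr normr0 mulr0 integral0_eq// => p _.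
  by rewrite energyE subrr expr0n mulr0 mul0r.
rewrite integral_energy// distrC gtr0_norm ?subr_gt0// mulrC EFinM.
congr (_ * _)%E; rewrite /energy_cst /Rintegral fineK//.
rewrite ge0_fin_numE ?integral_energy01_lty// integral_ge0// => p _.
by rewrite lee_fin energy_ge0.
Qed.

Lemma energy_cst_ge0 : 0 <= energy_cst.
Proof. by apply: Rintegral_ge0 => p _; exact: energy_ge0. Qed.

(** Polarisation of [has_integral_energy]. The bracket is the covariance of
    Brownian increments: it vanishes when the intervals are disjoint. *)
Lemma has_integral_gram a b c d : has_integral leb2
  (fun p => `|p.2| * ((kre 0 a p - kre 0 b p) * (kre 0 c p - kre 0 d p) +
                      (kim 0 a p - kim 0 b p) * (kim 0 c p - kim 0 d p)))
  (energy_cst / 2 * (`|a - d| + `|b - c| - `|a - c| - `|b - d|)).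
Proof.
have E := has_integral_energy.
have := has_integralZ (2^-1) (has_integralD (has_integralD (E a d) (E b c))
  (has_integralD (has_integralN (E a c)) (has_integralN (E b d)))).
rewrite (_ : 2^-1 * _ = energy_cst / 2 * (`|a - d| + `|b - c| - `|a - c| - `|b - d|)).
  by apply: eq_has_integral => p; rewrite /energy; field.
by field.
Qed.

Definition pole_sum (k : R -> R * R -> R) (n : nat) (c t : nat -> R) (p : R * R) : R :=
  \sum_(i < n) c i * (k (t i) p - k (t i.+1) p).

(** Pythagoras: the increments of the kernel along a subdivision are pairwise
    orthogonal in [L^2(|y| dm)]. *)
Lemma has_integral_pole_sum n (c t : nat -> R) :
  (forall k, (k < n)%N -> t k <= t k.+1) ->
  has_integral leb2
    (fun p => `|p.2| * (pole_sum (kre 0) n c t p ^+ 2 + pole_sum (kim 0) n c t p ^+ 2))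
    (energy_cst * \sum_(k < n) c k ^+ 2 * (t k.+1 - t k)).
Proof.
move=> tS.
have t_le i j : (i <= j)%N -> (j <= n)%N -> t i <= t j.
  elim: j => [|j IH]; first by rewrite leqn0 => /eqP ->.
  rewrite leq_eqVlt => /predU1P[->//|ij] jn.
  by rewrite (le_trans (IH _ _)) ?tS// ltnW.
pose G i j p := `|p.2| *
  ((kre 0 (t i) p - kre 0 (t i.+1) p) * (kre 0 (t j) p - kre 0 (t j.+1) p) +
   (kim 0 (t i) p - kim 0 (t i.+1) p) * (kim 0 (t j) p - kim 0 (t j.+1) p)).
have HG i j : (i < n)%N -> (j < n)%N ->
    has_integral leb2 (G i j) (if i == j then energy_cst * (t i.+1 - t i) else 0).
  move=> iN jn.
  have := has_integral_gram (t i) (t i.+1) (t j) (t j.+1).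
  set v := _ / 2 * _; suff -> : v = if i == j then energy_cst * (t i.+1 - t i) else 0 by [].
  rewrite /v; case: eqP => [->|/eqP].
    have tj := tS _ jn; rewrite !subrr normr0 !subr0 distrC.
    by rewrite ger0_norm ?subr_ge0//; field.
  (* disjoint intervals: all the differences below have the same sign *)
  rewrite neq_ltn => /orP[] ij.
    rewrite !ler0_norm ?subr_le0; last first.
    all: try by apply: t_le => //; lia.
    by ring.
  rewrite !ger0_norm ?subr_ge0; last first.
  all: try by apply: t_le => //; lia.
  by ring.
have := @has_integral_sum _ _ _ leb2 n
  (fun i p => \sum_(j < n) c i * c j * G i j p)
  (fun i => \sum_(j < n) c i * c j * (if i == j then energy_cst * (t i.+1 - t i) else 0)).
have -> : \sum_(i < n) \sum_(j < n) c i * c j *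
    (if i == j :> nat then energy_cst * (t i.+1 - t i) else 0) =
    energy_cst * \sum_(k < n) c k ^+ 2 * (t k.+1 - t k).
  rewrite mulr_sumr; apply: eq_bigr => i _; rewrite (bigD1 i)//= eqxx big1 ?addr0.
    by ring.
  by move=> j; rewrite eq_sym -val_eqE/= => /negbTE ->; rewrite mulr0.
move=> H; apply: eq_has_integral (H _) => [p|i iN].
  rewrite /pole_sum !expr2 !mulr_suml -big_split/= mulr_sumr.
  apply: eq_bigr => i _; rewrite !mulr_sumr -big_split/= mulr_sumr.
  by apply: eq_bigr => j _; rewrite /G; ring.
apply: (@has_integral_sum _ _ _ leb2 n (fun j p => c i * c j * G i j p)
  (fun j => c i * c j * (if i == j then energy_cst * (t i.+1 - t i) else 0))).
by move=> j jn; apply: has_integralZ; exact: HG.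
Qed.

End CauchyKernel.

(** * Dominated convergence and the approximate identity *)

Section DominatedConvergence.
Context d (T : measurableType d) (R : realType).
Context (mu : {measure set T -> \bar R}).

Lemma Rintegral_dominated_cvg (f_ : nat -> T -> R) (f g : T -> R) :
  (forall n, measurable_fun setT (f_ n)) -> measurable_fun setT f ->
  mu.-integrable setT (EFin \o g) -> (forall n x, `|f_ n x| <= g x) ->
  (forall x, f_ ^~ x @ \oo --> f x) ->
  mu.-integrable setT (EFin \o f) /\
  (fun n => \int[mu]_x f_ n x) @ \oo --> \int[mu]_x f x.
Proof.
move=> mf_ mf ig fg f_f.
have [||||if_ _ c] := @dominated_convergence _ _ _ mu setT measurableT
    (fun n => EFin \o f_ n) (EFin \o f) (EFin \o g) _ _ _ ig _.
- by move=> n; exact/measurable_EFinP.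
- exact/measurable_EFinP.
- by apply: aeW => x _; apply: cvg_EFin; [exact: nearW|exact: f_f].
- by apply: aeW => x n _; rewrite lee_fin.
split=> //; apply: fine_cvg; rewrite fineK; first exact: c.
exact: integrable_fin_num.
Qed.

Lemma integrable_dominated (f g : T -> R) : measurable_fun setT f ->
  mu.-integrable setT (EFin \o g) -> (forall x, `|f x| <= g x) ->
  mu.-integrable setT (EFin \o f).
Proof.
move=> mf ig fg; apply: le_integrable ig => //; first exact/measurable_EFinP.
by move=> x _; rewrite lee_fin (le_trans (fg x))// ler_norm.
Qed.

End DominatedConvergence.

Section PoissonKernel.
Context {R : realType}.
Local Notation leb := (@lebesgue_measure R).
Local Notation leb2 := (lebesgue2 R).

(** Twice the d-bar derivative of [kre e a + i kim e a], an approximate identity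
    at [a] as [e] tends to [0]. *)
Definition pker (e a : R) (p : R * R) : R := 2 * e ^+ 2 / kden e a p ^+ 2.

Lemma pker_ge0 e a p : 0 <= pker e a p.
Proof. by rewrite divr_ge0 ?sqr_ge0// mulr_ge0 ?sqr_ge0. Qed.

Lemma measurable_pker e a : measurable_fun setT (pker e a).
Proof. rewrite /pker /kden; measurable_arith. Qed.

Lemma kden_gt0_reg (e a : R) p : 0 < e -> 0 < kden e a p.
Proof. by move=> e0; rewrite ltr_wpDl ?exprn_gt0// addr_ge0 ?sqr_ge0. Qed.

Lemma pker_affine (e a : R) p : 0 < e ->
  pker e a (e * p.1 + a, e * p.2) = e ^- 2 * pker 1 0 p.
Proof.
move=> e0; rewrite /pker.
have -> : kden e a (e * p.1 + a, e * p.2) = e ^+ 2 * kden 1 0 p.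
  by rewrite /kden/=; ring.
have := kden_gt0_reg 0 p ltr01; move: (kden 1 0 p) => D D0.
by field; rewrite !gt_eqF.
Qed.

Lemma integral_pker_lty : (\int[leb2]_p (pker 1 0 p)%:E < +oo)%E.
Proof.
have mD : measurable_fun [set: R * R] (fun p : R * R => (pker 1 0 p)%:E).
  by apply/measurable_EFinP; exact: measurable_pker.
have D0 p : (0 <= (pker 1 0 p)%:E)%E by rewrite lee_fin pker_ge0.
rewrite fubini_tonelli2//.
have V0 (x : R) : 0 <= (1 + x ^+ 2)^-1 by rewrite invr_ge0 addr_ge0 ?sqr_ge0.
apply: (@le_lt_trans _ _ (\int[leb]_y ((2 * pi * (1 + y ^+ 2)^-1)%:E))%E).
  apply: ge0_le_integral => //.
  - by move=> y _; exact: integral_ge0.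
  - exact: (@measurable_fun_fubini_tonelli_G _ _ _ _ R leb _ mD D0).
  - measurable_arith.
  move=> y _; rewrite mulrAC EFinM -integral_inv_oneDsqr -ge0_integralZl_EFin//;
    last 3 first.
  - by move=> x _; rewrite lee_fin.
  - measurable_arith.
  - by rewrite mulr_ge0.
  apply: ge0_le_integral => //.
  - rewrite /pker /kden/=; measurable_arith.
  - measurable_arith.
  move=> x _; rewrite -EFinM lee_fin /pker /kden/= subr0 !expr1n mulr1 -mulrA.
  rewrite ler_wpM2l// -invfM lef_pV2 ?posrE.
  - by have := sqr_ge0 x; have := sqr_ge0 y; nra.
  - by rewrite exprn_gt0// ltr_wpDl ?addr_ge0 ?sqr_ge0.
  - by rewrite mulr_gt0// ltr_wpDr ?sqr_ge0.
under eq_integral do rewrite EFinM.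
rewrite ge0_integralZl_EFin//; last 3 first.
- by move=> y _; rewrite lee_fin.
- measurable_arith.
- by rewrite mulr_ge0// pi_ge0.
by rewrite integral_inv_oneDsqr -EFinM ltry.
Qed.

(** Its value is [2 pi]. *)
Definition pker_mass : R := \int[leb2]_p pker 1 0 p.

Lemma integrable_pker : leb2.-integrable setT (EFin \o pker 1 0).
Proof.
apply: integrable_ge0 => //; first exact: measurable_pker.
  by move=> p; exact: pker_ge0.
exact: integral_pker_lty.
Qed.

Lemma pker_mass_gt0 : 0 < pker_mass.
Proof.
(* On the unit square [kden 1 0 <= 3], hence [pker 1 0 >= 2 / 9]. *)
pose A : set (R * R) := `[0, 1] `*` `[0, 1].
have mA : measurable A by apply: measurableX.
have A1 : leb2 A = 1%E.
  rewrite [LHS]product_measure1E//.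
  by rewrite /= !lebesgue_measure_itv/= lte_fin ltr01 -EFinB subr0 mule1.
rewrite (lt_le_trans (_ : 0 < 2 / 9))// /pker_mass.
rewrite -lee_fin /Rintegral fineK; last first.
  apply: integrable_fin_num => //; exact: integrable_pker.
apply: (@le_trans _ _ (\int[leb2]_(p in A) (2 / 9)%:E)%E).
  rewrite integral_cst//.
  by rewrite [X in (_ <= _ * X)%E](A1 : _ = _) mule1.
apply: (@le_trans _ _
    (\int[leb2]_(p in A) (pker 1 0 p)%:E)%E).
  apply: ge0_le_integral => //.
  - apply/measurable_EFinP; apply: measurable_funTS; exact: measurable_pker.
  move=> [x y] [/=]; rewrite !in_itv/= => /andP[x0 x1] /andP[y0 y1].
  rewrite lee_fin /pker /kden/= subr0 expr1n mulr1 ler_pM2l// lef_pV2 ?posrE//.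
    have x2 : x ^+ 2 <= 1 by rewrite expr_le1.
    have y2 : y ^+ 2 <= 1 by rewrite expr_le1.
    by have := sqr_ge0 x; have := sqr_ge0 y; nra.
  by rewrite exprn_gt0// ltr_wpDl ?addr_ge0 ?sqr_ge0.
apply: ge0_subset_integral => //.
  by apply/measurable_EFinP; exact: measurable_pker.
by move=> p _; rewrite lee_fin pker_ge0.
Qed.

(** The change of variables is known for nonnegative functions; [F + M] is one. *)
Lemma integral_pker_comp (e a : R) (F : R * R -> R) (M : R) : 0 < e ->
  measurable_fun setT F -> (forall p, `|F p| <= M) ->
  has_integral leb2 (fun p => F p * pker e a p)
    (\int[leb2]_p (F (e * p.1 + a, e * p.2) * pker 1 0 p)).
Proof.
move=> e0 mF FM.
have mA : measurable_fun setT (fun p : R * R => (e * p.1 + a, e * p.2)).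
  apply/measurable_fun_pair => /=; measurable_arith.
have mFA := measurableT_comp mF mA.
have ge0_case (G : R * R -> R) C : measurable_fun setT G ->
    (forall p, 0 <= G p <= C) -> has_integral leb2 (fun p => G p * pker e a p)
    (\int[leb2]_p (G (e * p.1 + a, e * p.2) * pker 1 0 p)).
  move=> mG GC; have mGA := measurableT_comp mG mA.
  have G0 p : 0 <= G p by have /andP[] := GC p.
  have mp := measurable_pker; have p0 := pker_ge0.
  apply: has_integral_ge0.
  - by apply: measurable_funM => //; exact: mp.
  - by move=> p; rewrite mulr_ge0 ?p0.
  rewrite -(@ge0_integral_affine2 _ e a (fun p => (G p * pker e a p)%:E))//; last 2 first.
  - by apply/measurable_EFinP; apply: measurable_funM => //; exact: mp.
  - by move=> p; rewrite lee_fin mulr_ge0 ?p0.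
  rewrite -ge0_integralZl_EFin ?sqr_ge0//; last 2 first.
  - by move=> p _; rewrite lee_fin mulr_ge0 ?p0.
  - apply/measurable_EFinP; apply: measurable_funM => //.
    by apply: (measurableT_comp (mp e a)).
  under eq_integral => p _.
    rewrite pker_affine// -EFinM mulrCA mulVKf ?expf_neq0 ?gt_eqF//.
    over.
  rewrite /Rintegral fineK//; apply: integrable_fin_num => //.
  refine (@integrable_dominated _ _ _ leb2
    (fun p => G (e * p.1 + a, e * p.2) * pker 1 0 p) (fun p => C * pker 1 0 p) _ _ _).
  - by apply: measurable_funM => //; exact: mp.
  - by have [] := has_integralZ C (has_integral_Rintegral integrable_pker).
  - move=> p; rewrite normrM ger0_norm ?G0// ger0_norm ?p0// ler_wpM2r ?p0//.
    by have /andP[] := GC (e * p.1 + a, e * p.2).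
have M0 : 0 <= M by apply: le_trans (FM (0, 0)).
have H1 := ge0_case (fun p => F p + M) (2 * M).
have {}H1 : has_integral leb2 (fun p => (F p + M) * pker e a p)
    (\int[leb2]_p ((F (e * p.1 + a, e * p.2) + M) * pker 1 0 p)).
  apply: H1; first measurable_arith.
  by move=> p; have := FM p; rewrite ler_norml; lra.
have H2 : has_integral leb2 (fun p => M * pker e a p)
    (\int[leb2]_p (M * pker 1 0 p)).
  by apply: (ge0_case (fun=> M) M); [measurable_arith|move=> p; rewrite M0 lexx].
have := has_integralD H1 (has_integralN H2).
have iM : leb2.-integrable setT (EFin \o (fun p : R * R => M * pker 1 0 p)).
  by have [] := has_integralZ M (has_integral_Rintegral integrable_pker).
rewrite (_ : _ + - _ = \int[leb2]_p (F (e * p.1 + a, e * p.2) * pker 1 0 p)).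
  by apply: eq_has_integral => p; ring.
rewrite -RintegralB//.
  by apply: eq_Rintegral => p _; ring.
refine (@integrable_dominated _ _ _ leb2
  (fun p => (F (e * p.1 + a, e * p.2) + M) * pker 1 0 p) (fun p => 2 * M * pker 1 0 p) _ _ _).
- by apply: measurable_funM; [apply: measurable_funD|exact: measurable_pker].
- by have [] := has_integralZ (2 * M) (has_integral_Rintegral integrable_pker).
- move=> p; rewrite normrM [`|pker _ _ _|]ger0_norm ?pker_ge0//.
  rewrite ler_wpM2r ?pker_ge0//.
  by have := FM (e * p.1 + a, e * p.2); rewrite !ler_norml; lra.
Qed.

Lemma cvg_integral_pker (F : R * R -> R) M a :
  measurable_fun setT F -> (forall p, `|F p| <= M) ->
  {for (a, 0), continuous F} ->
  (fun n => \int[leb2]_p (F p * pker n.+1%:R^-1 a p)) @ \oo -->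
    F (a, 0) * pker_mass.
Proof.
move=> mF FM cF.
have e0 n : 0 < n.+1%:R^-1 :> R by rewrite invr_gt0 ltr0n.
under eq_fun do rewrite (integral_pker_comp a (e0 _) mF FM).2.
have -> : F (a, 0) * pker_mass = \int[leb2]_p (F (a, 0) * pker 1 0 p).
  by have [_ ->] := has_integralZ (F (a, 0)) (has_integral_Rintegral integrable_pker).
have [] // := @Rintegral_dominated_cvg _ _ _ leb2
  (fun n p => F (n.+1%:R^-1 * p.1 + a, n.+1%:R^-1 * p.2) * pker 1 0 p)
  (fun p => F (a, 0) * pker 1 0 p) (fun p => M * pker 1 0 p).
- move=> n; apply: measurable_funM; last exact: measurable_pker.
  apply: (measurableT_comp mF).
  apply/measurable_fun_pair => /=; measurable_arith.
- by apply: measurable_funM; [exact: measurable_cst|exact: measurable_pker].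
- by have [] := has_integralZ M (has_integral_Rintegral integrable_pker).
- move=> n p; rewrite normrM [`|pker _ _ _|]ger0_norm ?pker_ge0//.
  by rewrite ler_wpM2r ?pker_ge0.
move=> p; apply: cvgM; last exact: cvg_cst.
have c1 : (fun n => n.+1%:R^-1 * p.1 + a) @ \oo --> a.
  rewrite -[X in _ --> X]add0r -[X in X + _](mul0r p.1).
  by apply: cvgD; [apply: cvgM; [exact: cvg_harmonic|exact: cvg_cst]|exact: cvg_cst].
have c2 : (fun n => n.+1%:R^-1 * p.2) @ \oo --> (0 : R).
  rewrite -[X in _ --> X](mul0r p.2).
  by apply: cvgM; [exact: cvg_harmonic|exact: cvg_cst].
have c3 := cvg_pair c1 c2.
exact: (cvg_comp _ _ (c3 _ _ _) cF).
Qed.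

End PoissonKernel.

(** * Bounded functions with compact support in the plane *)

Section CompactSupport.
Context {R : realType}.
Local Notation leb := (@lebesgue_measure R).
Local Notation leb2 := (lebesgue2 R).

Definition box_supp (M : R) (f : R * R -> R) : Prop :=
  forall p, (M < `|p.1|) || (M < `|p.2|) -> f p = 0.

Definition bounded_mfun (f : R * R -> R) : Prop :=
  measurable_fun setT f /\ exists C, forall p, `|f p| <= C.

Lemma bounded_mfunD f g : bounded_mfun f -> bounded_mfun g ->
  bounded_mfun (fun p => f p + g p).
Proof.
move=> [mf [C fC]] [mg [D gD]]; split; first exact: measurable_funD.
by exists (C + D) => p; rewrite (le_trans (ler_normD _ _))// lerD.
Qed.

Lemma bounded_mfunN f : bounded_mfun f -> bounded_mfun (fun p => - f p).
Proof.
by move=> [mf [C fC]]; split; [exact: measurable_funN|exists C => p; rewrite normrN].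
Qed.

Lemma bounded_mfunM f g : bounded_mfun f -> bounded_mfun g ->
  bounded_mfun (fun p => f p * g p).
Proof.
move=> [mf [C fC]] [mg [D gD]]; split; first exact: measurable_funM.
by exists (C * D) => p; rewrite normrM ler_pM.
Qed.

Lemma bounded_mfun1 (f : R -> R) : measurable_fun setT f ->
  (exists C, forall x, `|f x| <= C) ->
  bounded_mfun (fun p => f p.1) /\ bounded_mfun (fun p => f p.2).
Proof.
move=> mf [C fC]; split; split; try by exists C => p.
  exact: (measurableT_comp mf measurable_fst).
exact: (measurableT_comp mf measurable_snd).
Qed.

Lemma box_suppM M f g : box_supp M f -> box_supp M (fun p => f p * g p).
Proof. by move=> fM p pM; rewrite fM// mul0r. Qed.

Lemma box_suppMr M f g : box_supp M g -> box_supp M (fun p => f p * g p).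
Proof. by move=> gM p pM; rewrite gM// mulr0. Qed.

Lemma box_suppD M f g : box_supp M f -> box_supp M g ->
  box_supp M (fun p => f p + g p).
Proof. by move=> fM gM p pM; rewrite fM// gM// addr0. Qed.

Lemma box_suppN M f : box_supp M f -> box_supp M (fun p => - f p).
Proof. by move=> fM p pM; rewrite fM// oppr0. Qed.

Lemma compact_box (M : R) : compact (`[- M, M] `*` `[- M, M] : set (R * R)).
Proof. by apply: compact_setX; exact: segment_compact. Qed.

Lemma box_supp_compact M f : box_supp M f -> compact (closure [set p | f p != 0]).
Proof.
move=> fM; apply: (@subclosed_compact _ _ (`[- M, M] `*` `[- M, M])).
- exact: closed_closure.
- exact: compact_box.
have cB : closed (`[- M, M] `*` `[- M, M] : set (R * R)).
  by apply: compact_closed; [exact: norm_hausdorff|exact: compact_box].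
rewrite [X in _ `<=` X](closure_id _).1//; apply: closure_subset => p /= fp.
have /negP := contra_neqN (fM p) fp.
by move=> /negP; rewrite negb_or -!leNgt => /andP[]; rewrite !in_itv/= -!ler_norml.
Qed.

Lemma bounded_mfun_integrable M f : bounded_mfun f -> box_supp M f ->
  leb2.-integrable setT (EFin \o f).
Proof.
move=> [mf [C fC]] fM.
have mB : measurable (`[- M, M] `*` `[- M, M] : set (R * R)).
  by apply: measurableX; exact: measurable_itv.
have C0 : 0 <= C by apply: le_trans (fC (0, 0)).
refine (@integrable_dominated _ _ _ leb2 f
  (fun p => C * \1_(`[- M, M] `*` `[- M, M]) p) mf _ _); last first.
  move=> p; rewrite indicE.
  have [/set_mem pB|/negP pB] := boolP (p \in _); first by rewrite mulr1.
  rewrite mulr0 fM ?normr0//; apply/negPn/negP; rewrite negb_or -!leNgt => /andP[p1 p2].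
  by apply: pB; apply/mem_set; split; rewrite /= in_itv/= -ler_norml.
have iB : leb2.-integrable setT
    (EFin \o (\1_(`[- M, M] `*` `[- M, M]) : R * R -> R)).
  apply: integrable_ge0 => //.
  rewrite integral_indic//= setIT [X in (X < _)%E]product_measure1E//=.
  pose I : set R := `[- M, M]%classic; have lM : (leb I < +oo)%E.
    by rewrite /I lebesgue_measure_itv/=; case: ifP => _; rewrite -?EFinB ltry.
  by rewrite lte_mul_pinfty// ge0_fin_numE.
exact: (has_integralZ C (has_integral_Rintegral iB)).1.
Qed.

Lemma continuous_box_bounded M (u f : R * R -> R) : continuous u ->
  measurable_fun setT u -> bounded_mfun f -> box_supp M f ->
  bounded_mfun (fun p => u p * f p).
Proof.
move=> cu mu [mf [C fC]] fM; split; first exact: measurable_funM.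
have : compact (u @` (`[- M, M] `*` `[- M, M])).
  apply: continuous_compact; last exact: compact_box.
  exact: continuous_subspaceT.
move=> /compact_bounded[A [_ /(_ (`|A| + 1))]].
rewrite (le_lt_trans (ler_norm A)) ?ltrDl// => /(_ isT) uA.
exists ((`|A| + 1) * C) => p; have [pB|pB] := boolP ((M < `|p.1|) || (M < `|p.2|)).
  by rewrite fM// mulr0 normr0 mulr_ge0 ?addr_ge0// (le_trans _ (fC (0, 0))).
rewrite normrM ler_pM//; apply: uA.
exists p => //; move: pB; rewrite negb_or -!leNgt => /andP[p1 p2].
by split; rewrite /= in_itv/= -ler_norml.
Qed.

Lemma smooth_id : smooth (id : R -> R).
Proof.
case=> [|n]; first by split=> // x; exact: cvg_id.
apply: is_Cn_line => [x|x|]; first exact: cvg_id.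
  exact: derivable_id.
rewrite (_ : 'D_1 (id : R -> R) = fun=> 1); first exact: is_Cn_cst.
by apply/funext => x; exact: derive_id.
Qed.

Lemma smooth_fst (f : R -> R) : smooth f -> smooth (fun p : R * R => f p.1).
Proof.
move=> sf n; apply: (@is_Cn_affine _ _ _ n (fun p : R * R => p.1) (fun p => p.1)) => //.
by move=> p; exact: cvg_fst.
Qed.

Lemma smooth_snd (f : R -> R) : smooth f -> smooth (fun p : R * R => f p.2).
Proof.
move=> sf n; apply: (@is_Cn_affine _ _ _ n (fun p : R * R => p.2) (fun p => p.2)) => //.
by move=> p; exact: cvg_snd.
Qed.

Lemma smoothD (f g : R * R -> R) : smooth f -> smooth g -> smooth (fun p => f p + g p).
Proof. by move=> sf sg n; exact: is_CnD. Qed.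

Lemma smoothM (f g : R * R -> R) : smooth f -> smooth g -> smooth (fun p => f p * g p).
Proof. by move=> sf sg n; exact: is_CnM. Qed.

Lemma smoothN (f : R * R -> R) : smooth f -> smooth (fun p => - f p).
Proof. by move=> sf n; exact: is_CnN. Qed.

Lemma smooth_cst c : smooth (fun _ : R * R => c).
Proof. by move=> n; exact: is_Cn_cst. Qed.

Lemma smooth_kden (e a : R) : smooth (kden e a).
Proof.
have sx : smooth (fun p : R * R => p.1 - a).
  by apply: smoothD; [exact: (smooth_fst smooth_id)|exact: smooth_cst].
have sy := smooth_snd smooth_id.
by do 2 (apply: smoothD; last by [exact: smooth_cst|exact: smoothM]); exact: smoothM.
Qed.

Lemma smooth_kre (e a : R) : 0 < e -> smooth (kre e a).
Proof.
move=> e0; apply: smoothM.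
  by apply: smoothD; [exact: (smooth_fst smooth_id)|exact: smooth_cst].
by move=> n; apply: is_CnV; [move=> p; rewrite gt_eqF// kden_gt0_reg|exact: smooth_kden].
Qed.

Lemma smooth_kim (e a : R) : 0 < e -> smooth (kim e a).
Proof.
move=> e0; apply: smoothM; first exact: smoothN (smooth_snd smooth_id).
by move=> n; apply: is_CnV; [move=> p; rewrite gt_eqF// kden_gt0_reg|exact: smooth_kden].
Qed.

End CompactSupport.

(** * The almost analytic cutoff *)

Section PartialDerivatives.
Context {R : realType}.
Implicit Types (p v : R * R) (e a : R).

Lemma is_derive_dir (f : R -> R) (x w : R) : smooth f ->
  is_derive x w f (w * 'D_1 f x).
Proof.
move=> sf; have df : differentiable f x.
  by apply/derivable1_diffP; exact: smooth_derivable.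
split; first exact: smooth_derivable.
by rewrite !deriveE// -{1}[w]mulr1 -[w * 1]/(w *: 1) linearZ.
Qed.

Lemma is_derive_fst (f : R -> R) p v d :
  is_derive p.1 v.1 f d -> is_derive p v (fun q => f q.1) d.
Proof. by move=> [df <-]; split. Qed.

Lemma is_derive_snd (f : R -> R) p v d :
  is_derive p.2 v.2 f d -> is_derive p v (fun q => f q.2) d.
Proof. by move=> [df <-]; split. Qed.

Lemma is_deriveM_fun (f g : R * R -> R) p v df dg :
  is_derive p v f df -> is_derive p v g dg ->
  is_derive p v (fun q => f q * g q) (df * g p + f p * dg).
Proof.
move=> Hf Hg; have := @is_deriveM _ _ f g p v df dg Hf Hg.
by rewrite addrC [_ *: df]mulrC.
Qed.

Lemma is_deriveD_fun (f g : R * R -> R) p v df dg :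
  is_derive p v f df -> is_derive p v g dg ->
  is_derive p v (fun q => f q + g q) (df + dg).
Proof. exact: is_deriveD. Qed.

Lemma is_deriveN_fun (f : R * R -> R) p v df :
  is_derive p v f df -> is_derive p v (fun q => - f q) (- df).
Proof. exact: is_deriveN. Qed.

Lemma is_derive_subr a p v : is_derive p v (fun q : R * R => q.1 - a) v.1.
Proof.
have H1 : is_derive p v (fun q => q.1) v.1 by exact: (is_derive_fst (is_derive_id _ _)).
have H2 : is_derive p v (fun=> - a) 0 by exact: is_derive_cst.
by apply: is_derive_eq (is_deriveD_fun H1 H2) _; rewrite addr0.
Qed.

Lemma is_derive_kden e a p v :
  is_derive p v (kden e a) (2 * (p.1 - a) * v.1 + 2 * p.2 * v.2).
Proof.
have dx := is_derive_subr a p v.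
have dy : is_derive p v (fun q : R * R => q.2) v.2 by exact: (is_derive_snd (is_derive_id _ _)).
have H := is_deriveD_fun (is_deriveD_fun (is_deriveM_fun dx dx) (is_deriveM_fun dy dy))
  (@is_derive_cst _ _ _ (e ^+ 2) p v).
by apply: is_derive_eq H _; rewrite addr0; ring.
Qed.

Lemma is_derive_kre e a p v : 0 < e -> is_derive p v (kre e a)
  (v.1 / kden e a p -
   (p.1 - a) * (2 * (p.1 - a) * v.1 + 2 * p.2 * v.2) / kden e a p ^+ 2).
Proof.
move=> e0; have D0 : kden e a p != 0 by rewrite gt_eqF// kden_gt0_reg.
have dx := is_derive_subr a p v.
have [kd kE] := is_derive_kden e a p v.
have dV : is_derive p v (fun q => (kden e a q)^-1)
    (- (kden e a p ^- 2 * (2 * (p.1 - a) * v.1 + 2 * p.2 * v.2))).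
  by split; [exact: derivableV|rewrite deriveV// kE scaleNr].
apply: is_derive_eq (is_deriveM_fun dx dV) _.
by field.
Qed.

Lemma is_derive_kim e a p v : 0 < e -> is_derive p v (kim e a)
  (- v.2 / kden e a p +
   p.2 * (2 * (p.1 - a) * v.1 + 2 * p.2 * v.2) / kden e a p ^+ 2).
Proof.
move=> e0; have D0 : kden e a p != 0 by rewrite gt_eqF// kden_gt0_reg.
have dy : is_derive p v (fun q : R * R => - q.2) (- v.2).
  exact: (is_deriveN_fun (is_derive_snd (is_derive_id _ _))).
have [kd kE] := is_derive_kden e a p v.
have dV : is_derive p v (fun q => (kden e a q)^-1)
    (- (kden e a p ^- 2 * (2 * (p.1 - a) * v.1 + 2 * p.2 * v.2))).
  by split; [exact: derivableV|rewrite deriveV// kE scaleNr].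
apply: is_derive_eq (is_deriveM_fun dy dV) _.
by field.
Qed.

End PartialDerivatives.

Section AlmostAnalyticCutoff.
Context {R : realType}.
Context (N : R) (N0 : 0 < N).
Implicit Types (p v : R * R).

Let g := cutoff N.
Let g1 := 'D_1 g.
Let g2 := 'D_1 g1.

(** [chi1 + i chi2] is the almost analytic extension [g x + i y g' x] of the
    cutoff [g] of the line, cut off again in [y]. *)
Definition chi1 p := cutoff N p.1 * cutoff N p.2.
Definition chi2 p := p.2 * ('D_1 (cutoff N) p.1 * cutoff N p.2).

(** Its d-bar derivative vanishes on the real line: twice that derivative is
    [y (nu1 + i nu2)] with bounded [nu1] and [nu2]. *)
Definition nu1 p := - ('D_1 (cutoff N) p.1 * 'D_1 (cutoff N) p.2).
Definition nu2 p := cutoff N p.1 * ('D_1 (cutoff N) p.2 / p.2) +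
  'D_1 ('D_1 (cutoff N)) p.1 * cutoff N p.2.

Let sg : smooth g. Proof. exact: smooth_cutoff. Qed.
Let sg1 : smooth g1. Proof. exact: smooth_D1. Qed.
Let sg2 : smooth g2. Proof. exact: smooth_D1. Qed.

Let g_far x : N + 1 < `|x| -> g x = 0.
Proof. by move=> /ltW; exact: cutoff_eq0. Qed.
Let g1_far x : N + 1 < `|x| -> g1 x = 0.
Proof. by move: x; exact: derive_eq0_beyond. Qed.
Let g2_far x : N + 1 < `|x| -> g2 x = 0.
Proof. by move: x; exact: derive_eq0_beyond. Qed.

Let bounded_fst f : smooth f -> (forall x, N + 1 < `|x| -> f x = 0) ->
  bounded_mfun (fun p => f p.1).
Proof.
move=> sf /(continuous_supp_bounded (smooth_continuous sf))[C _ fC].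
apply: (bounded_mfun1 _ _).1; last by exists C.
by apply: continuous_measurable_fun; exact: smooth_continuous.
Qed.

Let bounded_snd f : smooth f -> (forall x, N + 1 < `|x| -> f x = 0) ->
  bounded_mfun (fun p => f p.2).
Proof.
move=> sf /(continuous_supp_bounded (smooth_continuous sf))[C _ fC].
apply: (bounded_mfun1 _ _).2; last by exists C.
by apply: continuous_measurable_fun; exact: smooth_continuous.
Qed.

(* [g1] vanishes near [0], so the division by [y] is harmless *)
Let bounded_quot : bounded_mfun (fun p => g1 p.2 / p.2).
Proof.
have [C C0 gC] := continuous_supp_bounded (smooth_continuous sg1) g1_far.
have mg : measurable_fun setT g1.
  by apply: continuous_measurable_fun; exact: smooth_continuous.
have mq : measurable_fun setT (fun y : R => g1 y / y).
  by measurable_arith.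
apply: (bounded_mfun1 mq _).2; exists (C / N) => y.
have [yN|yN] := ltP `|y| N.
  by rewrite /g1 cutoff_derive_eq0// mul0r normr0 divr_ge0// ltW.
rewrite normrM normfV ler_pM// lef_pV2 ?posrE//.
exact: lt_le_trans N0 yN.
Qed.

Let bounded_yg : bounded_mfun (fun p => p.2 * g p.2).
Proof.
have s : smooth (fun y : R => y * g y).
  by move=> n; apply: is_CnM => //; exact: smooth_id.
by apply: (bounded_snd s) => y yN; rewrite g_far// mulr0.
Qed.

Let box1 f : (forall x, N + 1 < `|x| -> f x = 0) -> forall h,
  (forall x, N + 1 < `|x| -> h x = 0) -> box_supp (N + 1) (fun p => f p.1 * h p.2).
Proof.
by move=> fN h hN p /orP[pN|pN]; [rewrite fN// mul0r|rewrite hN// mulr0].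
Qed.

Lemma bounded_chi1 : bounded_mfun chi1.
Proof. exact: bounded_mfunM (bounded_fst sg g_far) (bounded_snd sg g_far). Qed.

Lemma bounded_chi2 : bounded_mfun chi2.
Proof.
rewrite (_ : chi2 = fun p => g1 p.1 * (p.2 * g p.2)).
  exact: bounded_mfunM (bounded_fst sg1 g1_far) bounded_yg.
by apply/funext => p; rewrite /chi2 mulrCA.
Qed.

Lemma bounded_nu1 : bounded_mfun nu1.
Proof.
exact/bounded_mfunN/(bounded_mfunM (bounded_fst sg1 g1_far) (bounded_snd sg1 g1_far)).
Qed.

Lemma bounded_nu2 : bounded_mfun nu2.
Proof.
apply: bounded_mfunD.
  exact: bounded_mfunM (bounded_fst sg g_far) bounded_quot.
exact: bounded_mfunM (bounded_fst sg2 g2_far) (bounded_snd sg g_far).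
Qed.

Lemma box_chi1 : box_supp (N + 1) chi1.
Proof. exact: (box1 g_far g_far). Qed.

Lemma box_chi2 : box_supp (N + 1) chi2.
Proof. exact/box_suppMr/(box1 g1_far g_far). Qed.

Lemma box_nu1 : box_supp (N + 1) nu1.
Proof. exact/box_suppN/(box1 g1_far g1_far). Qed.

Lemma box_nu2 : box_supp (N + 1) nu2.
Proof.
apply: box_suppD; last exact: (box1 g2_far g_far).
by apply: (box1 g_far (h := fun y => g1 y / y)) => y yN; rewrite g1_far// mul0r.
Qed.

Lemma smooth_chi1 : smooth chi1.
Proof. exact: smoothM (smooth_fst sg) (smooth_snd sg). Qed.

Lemma smooth_chi2 : smooth chi2.
Proof.
apply: smoothM; first exact: (smooth_snd smooth_id).
exact: smoothM (smooth_fst sg1) (smooth_snd sg).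
Qed.

Lemma chi1_line x : `|x| <= N -> chi1 (x, 0) = 1.
Proof. by move=> xN; rewrite /chi1/= !cutoff_eq1 ?mulr1// normr0 ltW. Qed.

Lemma chi2_line x : chi2 (x, 0) = 0.
Proof. by rewrite /chi2/= mul0r. Qed.

Lemma is_derive_chi1 p v : is_derive p v chi1
  (v.1 * g1 p.1 * g p.2 + g p.1 * (v.2 * g1 p.2)).
Proof.
exact: is_deriveM_fun (is_derive_fst (is_derive_dir p.1 v.1 sg))
  (is_derive_snd (is_derive_dir p.2 v.2 sg)).
Qed.

Lemma is_derive_chi2 p v : is_derive p v chi2
  (v.2 * (g1 p.1 * g p.2) +
   p.2 * (v.1 * g2 p.1 * g p.2 + g1 p.1 * (v.2 * g1 p.2))).
Proof.
exact: is_deriveM_fun (is_derive_snd (is_derive_id _ _))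
  (is_deriveM_fun (is_derive_fst (is_derive_dir p.1 v.1 sg1))
    (is_derive_snd (is_derive_dir p.2 v.2 sg))).
Qed.

Lemma dbar_chi_nu2 p : p.2 * nu2 p = g p.1 * g1 p.2 + p.2 * (g2 p.1 * g p.2).
Proof.
rewrite /nu2 mulrDr; congr (_ + _).
have [->|y0] := eqVneq p.2 0.
  by rewrite mul0r /g1 cutoff_derive_eq0 ?normr0// mulr0.
by rewrite mulrCA; congr (_ * _); rewrite mulrC divfK.
Qed.

End AlmostAnalyticCutoff.

(** * The Cauchy-Pompeiu formula on the real line *)

Section CauchyPompeiu.
Context {R : realType}.
Local Notation leb := (@lebesgue_measure R).
Local Notation leb2 := (lebesgue2 R).

(** [b1 + i b2] is twice the d-bar derivative of the continuous function
    [u + i v], normalised to vanish on the real line. The last field is the real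
    part of Green's formula against the complex test function [f + i g]. *)
Record dbar_pair (u v b1 b2 : R * R -> R) : Prop := DbarPair {
  dbar_cu : continuous u;
  dbar_cv : continuous v;
  dbar_mu : measurable_fun setT u;
  dbar_mv : measurable_fun setT v;
  dbar_m1 : measurable_fun setT b1;
  dbar_m2 : measurable_fun setT b2;
  dbar_line : forall p, p.2 = 0 -> b1 p = 0 /\ b2 p = 0;
  dbar_int : (\int[leb2]_p ((b1 p ^+ 2 + b2 p ^+ 2) / `|p.2|)%:E < +oo)%E;
  dbar_green : forall f g, test_function f -> test_function g ->
    \int[leb2]_p (b1 p * f p - b2 p * g p) =
    - \int[leb2]_p (u p * ('D_(1, 0) f p - 'D_(0, 1) g p)
                  - v p * ('D_(0, 1) f p + 'D_(1, 0) g p)) }.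

(** The function [(u + i v) (chi1 + i chi2)] has compact support, agrees with
    [u + i v] at the real points [`|x| <= N], and twice its d-bar derivative is [al1 + i al2]. Since
    the d-bar derivative of the cutoff is [O(y)], [al1 + i al2] is still square
    integrable for [dm / |y|]. *)
Section Localisation.
Context (u v b1 b2 : R * R -> R) (uv : dbar_pair u v b1 b2).
Context (N : R) (N0 : 0 < N).
Local Notation M := (N + 1).

Let w1 p := u p * nu1 N p - v p * nu2 N p.
Let w2 p := u p * nu2 N p + v p * nu1 N p.
Let al1 p := b1 p * chi1 N p - b2 p * chi2 N p + p.2 * w1 p.
Let al2 p := b1 p * chi2 N p + b2 p * chi1 N p + p.2 * w2 p.
Let F p := u p * chi1 N p - v p * chi2 N p.

Let cu := dbar_cu uv.
Let cv := dbar_cv uv.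
Let mu := dbar_mu uv.
Let mv := dbar_mv uv.
Let m1 := dbar_m1 uv.
Let m2 := dbar_m2 uv.

Let bounded_w1 : bounded_mfun w1.
Proof.
apply: bounded_mfunD.
  exact: continuous_box_bounded cu mu (bounded_nu1 N) (@box_nu1 _ N).
apply: bounded_mfunN.
exact: continuous_box_bounded cv mv (bounded_nu2 N0) (@box_nu2 _ N).
Qed.

Let bounded_w2 : bounded_mfun w2.
Proof.
apply: bounded_mfunD.
  exact: continuous_box_bounded cu mu (bounded_nu2 N0) (@box_nu2 _ N).
exact: continuous_box_bounded cv mv (bounded_nu1 N) (@box_nu1 _ N).
Qed.

Let box_w1 : box_supp M w1.
Proof.
by apply: box_suppD; [|apply: box_suppN]; apply: box_suppMr;
  [exact: box_nu1|exact: box_nu2].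
Qed.

Let box_w2 : box_supp M w2.
Proof.
by apply: box_suppD; apply: box_suppMr; [exact: box_nu2|exact: box_nu1].
Qed.

Let bounded_F : bounded_mfun F.
Proof.
apply: bounded_mfunD.
  exact: continuous_box_bounded cu mu (bounded_chi1 N) (@box_chi1 _ N).
apply: bounded_mfunN.
exact: continuous_box_bounded cv mv (bounded_chi2 N) (@box_chi2 _ N).
Qed.

Let mal1 : measurable_fun setT al1.
Proof.
have [c1 _] := bounded_chi1 N; have [c2 _] := bounded_chi2 N.
have [mw1 _] := bounded_w1; rewrite /al1; measurable_arith.
Qed.

Let mal2 : measurable_fun setT al2.
Proof.
have [c1 _] := bounded_chi1 N; have [c2 _] := bounded_chi2 N.
have [mw2 _] := bounded_w2; rewrite /al2; measurable_arith.
Qed.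

Let al_line p : p.2 = 0 -> al1 p = 0 /\ al2 p = 0.
Proof.
move=> p0; have [b10 b20] := dbar_line uv p0.
by rewrite /al1 /al2 b10 b20 p0 !mul0r subrr !addr0.
Qed.

Let box_al1 : box_supp M al1.
Proof.
move=> p pM; rewrite /al1 box_w1//.
by rewrite (@box_chi1 _ N p pM) (@box_chi2 _ N p pM) !mulr0 subrr addr0.
Qed.

Let box_al2 : box_supp M al2.
Proof.
move=> p pM; rewrite /al2 box_w2//.
by rewrite (@box_chi1 _ N p pM) (@box_chi2 _ N p pM) !mulr0 !addr0.
Qed.

Let al_energy :
  leb2.-integrable setT (EFin \o (fun p => (al1 p ^+ 2 + al2 p ^+ 2) / `|p.2|)).
Proof.
have [c1 [C1 C1P]] := bounded_chi1 N; have [c2 [C2 C2P]] := bounded_chi2 N.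
have b_int : leb2.-integrable setT
    (EFin \o (fun p => (b1 p ^+ 2 + b2 p ^+ 2) / `|p.2|)).
  apply: integrable_ge0; last exact: dbar_int uv.
    by have := m1; have := m2 => ? ?; measurable_arith.
  by move=> p; rewrite divr_ge0 ?addr_ge0 ?sqr_ge0.
have w_int : leb2.-integrable setT
    (EFin \o (fun p => `|p.2| * (w1 p ^+ 2 + w2 p ^+ 2))).
  apply: (@bounded_mfun_integrable _ M); last first.
    by move=> p pM; rewrite box_w1// box_w2// expr0n addr0 mulr0.
  apply: (@continuous_box_bounded _ M (fun p => `|p.2|)).
  - by move=> p; apply: cvg_norm; exact: cvg_snd.
  - by measurable_arith.
  - by rewrite /= ; apply: bounded_mfunD; exact: bounded_mfunM.
  - by move=> p pM; rewrite box_w1// box_w2// expr0n addr0.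
set K := 2 * (C1 ^+ 2 + C2 ^+ 2).
have dom := has_integralD (has_integralZ K (has_integral_Rintegral b_int))
  (has_integralZ 2 (has_integral_Rintegral w_int)).
refine (@integrable_dominated _ _ _ leb2 _ _ _ dom.1 _).
  have := mal1; have := mal2 => ? ?; measurable_arith.
move=> p; rewrite ger0_norm ?divr_ge0 ?addr_ge0 ?sqr_ge0//.
have [y0|y0] := eqVneq p.2 0.
  have [-> ->] := al_line y0.
  by rewrite y0 normr0 invr0 !mulr0 mul0r mulr0 addr0.
have ny : 0 < `|p.2| by rewrite normr_gt0.
rewrite ler_pdivrMr// mulrDl.
have -> : K * ((b1 p ^+ 2 + b2 p ^+ 2) / `|p.2|) * `|p.2| =
  K * (b1 p ^+ 2 + b2 p ^+ 2) by rewrite -mulrA divfK// normr_eq0.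
have -> : 2 * (`|p.2| * (w1 p ^+ 2 + w2 p ^+ 2)) * `|p.2| =
    2 * p.2 ^+ 2 * (w1 p ^+ 2 + w2 p ^+ 2).
  by rewrite -[p.2 ^+ 2]real_normK ?num_real//; ring.
have c1C : chi1 N p ^+ 2 <= C1 ^+ 2.
  by rewrite -[chi1 N p ^+ 2]real_normK ?num_real// lerXn2r ?nnegrE// (le_trans _ (C1P p)).
have c2C : chi2 N p ^+ 2 <= C2 ^+ 2.
  by rewrite -[chi2 N p ^+ 2]real_normK ?num_real// lerXn2r ?nnegrE// (le_trans _ (C2P p)).
(* |A + B|^2 <= 2 |A|^2 + 2 |B|^2 and the modulus is multiplicative *)
apply: (@le_trans _ _ (2 * ((chi1 N p ^+ 2 + chi2 N p ^+ 2) * (b1 p ^+ 2 + b2 p ^+ 2)) +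
    2 * p.2 ^+ 2 * (w1 p ^+ 2 + w2 p ^+ 2))).
  rewrite /al1 /al2 -subr_ge0.
  rewrite (_ : _ - _ = (b1 p * chi1 N p - b2 p * chi2 N p - p.2 * w1 p) ^+ 2 +
    (b1 p * chi2 N p + b2 p * chi1 N p - p.2 * w2 p) ^+ 2); last by ring.
  by rewrite addr_ge0 ?sqr_ge0.
rewrite lerD2r /K -mulrA ler_pM2l// ler_wpM2r ?addr_ge0 ?sqr_ge0//.
exact: lerD.
Qed.

Let dom a p := (al1 p ^+ 2 + al2 p ^+ 2) / `|p.2| +
  (1 + 5 * M ^+ 2) * dens a p.

Let dom_int a : leb2.-integrable setT (EFin \o dom a).
Proof.
have d_int : leb2.-integrable setT (EFin \o dens a).
  apply: integrable_ge0; last exact: integral_dens_lty.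
    exact: measurable_dens.
  exact: dens_ge0.
exact: (has_integralD (has_integral_Rintegral al_energy)
  (has_integralZ _ (has_integral_Rintegral d_int))).1.
Qed.

(** Arithmetic-geometric mean: [|al K| <= |al|^2 / |y| + |y| |K|^2]. The bound is
    uniform in the regularisation [e], including [e = 0]. *)
Let dom_le (e a : R) p : `|a| <= N ->
  `|al1 p * kre e a p - al2 p * kim e a p| <= dom a p.
Proof.
move=> aN; have dom0 : 0 <= dom a p.
  apply: addr_ge0; first by rewrite divr_ge0 ?addr_ge0 ?sqr_ge0.
  by rewrite mulr_ge0 ?dens_ge0// addr_ge0// mulr_ge0 ?sqr_ge0.
have [y0|y0] := eqVneq p.2 0.
  by have [-> ->] := al_line y0; rewrite !mul0r subrr normr0.
have [pM|pM] := boolP ((M < `|p.1|) || (M < `|p.2|)).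
  by rewrite box_al1// box_al2// !mul0r subrr normr0.
have ny : 0 < `|p.2| by rewrite normr_gt0.
set A := (p.1 - a) ^+ 2 + p.2 ^+ 2.
have A0 : 0 < A by rewrite ltr_wpDl ?sqr_ge0// exprn_even_gt0.
have AM : A <= 5 * M ^+ 2.
  move: pM aN; rewrite negb_or -!leNgt !ler_norml /A => /andP[/andP[x1 x2] /andP[y1 y2]].
  move=> /andP[a1 a2].
  have : (p.1 - a) ^+ 2 <= (2 * M) ^+ 2.
    rewrite -[_ ^+ 2]real_normK ?num_real// lerXn2r ?nnegrE//; first lra.
    by rewrite ler_norml; lra.
  have : p.2 ^+ 2 <= M ^+ 2.
    rewrite -[_ ^+ 2]real_normK ?num_real// lerXn2r ?nnegrE//; first lra.
    by rewrite ler_norml y1 y2.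
  by nra.
have DA : A <= kden e a p by rewrite lerDl sqr_ge0.
have D0 : 0 < kden e a p by exact: kden_gt0.
have kk : `|p.2| * (kre e a p ^+ 2 + kim e a p ^+ 2) <=
    (1 + 5 * M ^+ 2) * dens a p.
  have -> : `|p.2| * (kre e a p ^+ 2 + kim e a p ^+ 2) =
      `|p.2| * (A / kden e a p ^+ 2).
    by congr (_ * _); rewrite /kre /kim /A; field; rewrite gt_eqF.
  rewrite /dens -/A [X in _ <= X]mulrCA ler_wpM2l//.
  apply: (@le_trans _ _ A^-1).
    rewrite ler_pdivrMr ?exprn_gt0// mulrC ler_pdivlMr// -expr2.
    by rewrite lerXn2r ?nnegrE// ltW.
  have A1 : 0 < 1 + A by lra.
  rewrite invfM mulrCA ler_peMr ?invr_ge0 ?(ltW A0)// ler_pdivlMr// mul1r.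
  by rewrite lerD2l.
apply: le_trans (_ : _ <= (al1 p ^+ 2 + al2 p ^+ 2) / `|p.2| +
  `|p.2| * (kre e a p ^+ 2 + kim e a p ^+ 2)) _; last by rewrite lerD2l.
move: ny (al1 p) (al2 p) (kre e a p) (kim e a p); move: `|p.2| => n n0 c1 c2 k1 k2.
have amgm s t : `|s * t| <= (s ^+ 2 / n + n * t ^+ 2) / 2.
  have -> : (s ^+ 2 / n + n * t ^+ 2) / 2 = (s ^+ 2 + (n * t) ^+ 2) / (2 * n).
    by field; rewrite gt_eqF.
  rewrite ler_pdivlMr ?mulr_gt0//.
  have -> : `|s * t| * (2 * n) = 2 * (`|s| * `|n * t|).
    by rewrite !normrM (gtr0_norm n0); ring.
  rewrite -[s ^+ 2]real_normK ?num_real// -[(n * t) ^+ 2]real_normK ?num_real//.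
  by have := sqr_ge0 (`|s| - `|n * t|); nra.
rewrite (le_trans (ler_normB _ _))// (le_trans (lerD (amgm _ _) (amgm _ _)))//.
have p1 : 0 <= c1 ^+ 2 / n by rewrite divr_ge0 ?sqr_ge0 ?ltW.
have p2 : 0 <= c2 ^+ 2 / n by rewrite divr_ge0 ?sqr_ge0 ?ltW.
have p3 : 0 <= n * k1 ^+ 2 by rewrite mulr_ge0 ?sqr_ge0 ?ltW.
have p4 : 0 <= n * k2 ^+ 2 by rewrite mulr_ge0 ?sqr_ge0 ?ltW.
by rewrite mulrDl mulrDr; lra.
Qed.

Let tre e a p := chi1 N p * kre e a p - chi2 N p * kim e a p.
Let tim e a p := chi1 N p * kim e a p + chi2 N p * kre e a p.

Let test_tre (e a : R) : 0 < e -> test_function (tre e a).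
Proof.
move=> e0; split.
  have s1 := smoothM (@smooth_chi1 _ N) (smooth_kre a e0).
  have s2 := smoothM (@smooth_chi2 _ N) (smooth_kim a e0).
  exact: smoothD s1 (smoothN s2).
apply: (@box_supp_compact _ M).
apply: box_suppD; last apply: box_suppN; apply: box_suppM.
  exact: box_chi1.
exact: box_chi2.
Qed.

Let test_tim (e a : R) : 0 < e -> test_function (tim e a).
Proof.
move=> e0; split.
  have s1 := smoothM (@smooth_chi1 _ N) (smooth_kim a e0).
  have s2 := smoothM (@smooth_chi2 _ N) (smooth_kre a e0).
  exact: smoothD s1 s2.
apply: (@box_supp_compact _ M).
by apply: box_suppD; apply: box_suppM; [exact: box_chi1|exact: box_chi2].
Qed.

(** Leibniz rule: the d-bar derivative of the test function, using that the
    regularised Cauchy kernel has d-bar derivative [pker / 2]. *)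
Let dbar_test (e a : R) p : 0 < e ->
  'D_(1, 0) (tre e a) p - 'D_(0, 1) (tim e a) p =
    p.2 * nu1 N p * kre e a p - p.2 * nu2 N p * kim e a p + chi1 N p * pker e a p /\
  'D_(0, 1) (tre e a) p + 'D_(1, 0) (tim e a) p =
    p.2 * nu1 N p * kim e a p + p.2 * nu2 N p * kre e a p + chi2 N p * pker e a p.
Proof.
move=> e0.
have dre v := is_deriveD_fun
  (is_deriveM_fun (is_derive_chi1 N p v) (is_derive_kre a p v e0))
  (is_deriveN_fun (is_deriveM_fun (is_derive_chi2 N p v) (is_derive_kim a p v e0))).
have dim v := is_deriveD_fun
  (is_deriveM_fun (is_derive_chi1 N p v) (is_derive_kim a p v e0))
  (is_deriveM_fun (is_derive_chi2 N p v) (is_derive_kre a p v e0)).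
have [_ re1] := dre (1, 0); have [_ re2] := dre (0, 1).
have [_ im1] := dim (1, 0); have [_ im2] := dim (0, 1).
rewrite /tre /tim re1 re2 im1 im2 (dbar_chi_nu2 N0) /nu1 /chi1 /chi2 /pker /kre /kim /=.
have := gt_eqF (kden_gt0_reg a p e0).
rewrite /kden => D0.
by split; field; rewrite D0.
Qed.

Let bounded_kernel (e a : R) : 0 < e ->
  [/\ bounded_mfun (kre e a), bounded_mfun (kim e a) & bounded_mfun (pker e a)].
Proof.
move=> e0.
have D0 p := kden_gt0_reg a p e0.
have half s p : s ^+ 2 + e ^+ 2 <= kden e a p -> `|s / kden e a p| <= e^-1.
  move=> sD; rewrite normrM normfV (gtr0_norm (D0 p)) ler_pdivrMr//.
  rewrite mulrC ler_pdivlMr//; apply: le_trans sD.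
  rewrite -[s ^+ 2]real_normK ?num_real//.
  by have := sqr_ge0 (`|s| - e); have := normr_ge0 s; nra.
split; split.
- exact: measurable_kre.
- by exists e^-1 => p; apply: half; rewrite /kden lerD2r lerDl sqr_ge0.
- exact: measurable_kim.
- by exists e^-1 => p; apply: half; rewrite /kden lerD2r sqrrN lerDr sqr_ge0.
- exact: measurable_pker.
exists (2 / e ^+ 2) => p; rewrite ger0_norm ?pker_ge0// /pker.
rewrite ler_pdivrMr ?exprn_gt0// -mulrA ler_pM2l//.
rewrite mulrC ler_pdivlMr ?exprn_gt0// -expr2.
rewrite lerXn2r ?nnegrE ?sqr_ge0// ?(ltW (D0 p))//.
by rewrite /kden lerDr addr_ge0 ?sqr_ge0.
Qed.

(** Green's formula against [chi K], where [K] is the regularised kernel: the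
    terms carrying the derivative of [chi] are moved to the left and turn
    [b1 + i b2] into [al1 + i al2]. *)
Let cauchy_regularised (e a : R) : 0 < e -> `|a| <= N ->
  has_integral leb2 (fun p => al1 p * kre e a p - al2 p * kim e a p)
    (- \int[leb2]_p (F p * pker e a p)).
Proof.
move=> e0 aN.
have [bre bim bpk] := bounded_kernel a e0.
have [mF [CF FC]] := bounded_F.
have iF := (integral_pker_comp a e0 mF FC).1.
have ial : leb2.-integrable setT
    (EFin \o (fun p => al1 p * kre e a p - al2 p * kim e a p)).
  refine (@integrable_dominated _ _ _ leb2 _ _ _ (dom_int a) _).
    have := mal1; have := mal2; have := measurable_kre e a.
    have := measurable_kim e a => ? ? ? ?; measurable_arith.
  by move=> p; exact: dom_le.
pose G p := p.2 * w1 p * kre e a p - p.2 * w2 p * kim e a p + F p * pker e a p.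
have iG : leb2.-integrable setT (EFin \o G).
  have csnd : continuous (fun p : R * R => p.2) by move=> p; exact: cvg_snd.
  have by1 : bounded_mfun (fun p => p.2 * w1 p).
    exact: continuous_box_bounded csnd measurable_snd bounded_w1 box_w1.
  have by2 : bounded_mfun (fun p => p.2 * w2 p).
    exact: continuous_box_bounded csnd measurable_snd bounded_w2 box_w2.
  apply: (@bounded_mfun_integrable _ M).
    apply: bounded_mfunD; last exact: bounded_mfunM.
    by apply: bounded_mfunD; [|apply: bounded_mfunN]; exact: bounded_mfunM.
  move=> p pM; rewrite /G /F box_w1// box_w2//.
  by rewrite (@box_chi1 _ N p pM) (@box_chi2 _ N p pM) !(mulr0, mul0r, subrr, addr0).
have GE p : u p * ('D_(1, 0) (tre e a) p - 'D_(0, 1) (tim e a) p)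
    - v p * ('D_(0, 1) (tre e a) p + 'D_(1, 0) (tim e a) p) = G p.
  have [-> ->] := dbar_test a p e0; rewrite /G /F /w1 /w2; ring.
have BE p : b1 p * tre e a p - b2 p * tim e a p =
    al1 p * kre e a p - al2 p * kim e a p + (F p * pker e a p - G p).
  by rewrite /G /al1 /al2 /tre /tim; ring.
have := dbar_green uv (test_tre a e0) (test_tim a e0).
under eq_Rintegral do rewrite BE.
under [in X in _ = - X -> _]eq_Rintegral do rewrite GE.
have H := has_integralD (has_integral_Rintegral ial) (has_integralD
  (has_integral_Rintegral iF) (has_integralN (has_integral_Rintegral iG))).
rewrite H.2 => green; split=> //; apply/eqP; rewrite -addr_eq0; apply/eqP.
by rewrite addrA in green; apply: (addIr (- \int[leb2]_p G p)); rewrite add0r.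
Qed.

(** The real part of the Cauchy-Pompeiu formula, as [e] tends to [0] in
    [cauchy_regularised]. *)
Lemma localised_cauchy_pompeiu : exists al1 al2 : R * R -> R,
  [/\ measurable_fun setT al1 /\ measurable_fun setT al2,
      forall p, p.2 = 0 -> al1 p = 0 /\ al2 p = 0,
      leb2.-integrable setT (EFin \o (fun p => (al1 p ^+ 2 + al2 p ^+ 2) / `|p.2|)) &
      forall a, `|a| <= N -> has_integral leb2
        (fun p => al1 p * kre 0 a p - al2 p * kim 0 a p) (- (u (a, 0) * pker_mass))].
Proof.
exists al1, al2; split=> // a aN.
have e0 n : 0 < n.+1%:R^-1 :> R by rewrite invr_gt0 ltr0n.
have [mF [CF FC]] := bounded_F.
have Fa : F (a, 0) = u (a, 0).
  by rewrite /F chi1_line// chi2_line mulr1 mulr0 subr0.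
have cF : {for (a, 0), continuous F}.
  have c1 := smooth_continuous (@smooth_chi1 _ N).
  have c2 := smooth_continuous (@smooth_chi2 _ N).
  by apply: cvgB; apply: cvgM; [exact: cu|exact: c1|exact: cv|exact: c2].
have lim1 := cvg_integral_pker mF FC cF; rewrite Fa in lim1.
have mk e : measurable_fun setT (fun p => al1 p * kre e a p - al2 p * kim e a p).
  have := mal1; have := mal2; have := measurable_kre e a.
  have := measurable_kim e a => ? ? ? ?; measurable_arith.
have cvg_kden p : (fun n => kden n.+1%:R^-1 a p) @ \oo --> kden 0 a p.
  rewrite /kden expr0n; apply: cvgD; first exact: cvg_cst.
  rewrite -[X in _ --> X](mulr0 0).
  by under eq_fun do rewrite expr2; apply: cvgM; exact: cvg_harmonic.
have cvg_k (c : R * R -> R) p : (kden 0 a p = 0 -> c p = 0) ->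
    (fun n => c p / kden n.+1%:R^-1 a p) @ \oo --> c p / kden 0 a p.
  have [D0 /(_ D0) ->|D0 _] := eqVneq (kden 0 a p) 0.
    by under eq_fun do rewrite mul0r; rewrite mul0r; exact: cvg_cst.
  by apply: cvgM; [exact: cvg_cst|exact: cvgV].
have kden0 p : kden 0 a p = 0 -> p.1 - a = 0 /\ - p.2 = 0.
  rewrite /kden expr0n addr0 => /eqP; rewrite paddr_eq0 ?sqr_ge0// !sqrf_eq0.
  by move=> /andP[/eqP -> /eqP ->]; rewrite oppr0.
have [ial lim2] : leb2.-integrable setT
      (EFin \o (fun p => al1 p * kre 0 a p - al2 p * kim 0 a p)) /\
    (fun n => \int[leb2]_p (al1 p * kre n.+1%:R^-1 a p - al2 p * kim n.+1%:R^-1 a p))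
      @ \oo --> \int[leb2]_p (al1 p * kre 0 a p - al2 p * kim 0 a p).
  apply: (Rintegral_dominated_cvg _ _ (dom_int a)) => //.
  - by move=> n; exact: mk.
  - exact: mk.
  - by move=> n p; exact: (dom_le _ p aN).
  - move=> p; apply: cvgB; apply: cvgM; try exact: cvg_cst.
      by apply: (cvg_k (fun p => p.1 - a)) => /kden0[].
    by apply: (cvg_k (fun p => - p.2)) => /kden0[].
have reg n : \int[leb2]_p (al1 p * kre n.+1%:R^-1 a p - al2 p * kim n.+1%:R^-1 a p) =
  - \int[leb2]_p (F p * pker n.+1%:R^-1 a p) := (cauchy_regularised (e0 n) aN).2.
have lim3 : (fun n => \int[leb2]_p (al1 p * kre n.+1%:R^-1 a p - al2 p * kim n.+1%:R^-1 a p))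
    @ \oo --> - (u (a, 0) * pker_mass).
  by under eq_fun do rewrite reg; exact: cvgN.
by split=> //; exact: (cvg_unique _ lim2 lim3).
Qed.

End Localisation.

End CauchyPompeiu.

(** * From the d-bar derivative to the Riesz condition and to rectifiability *)

Section ComplexModulus.
Context {R : realType}.

Lemma le_Re_normc (z : R[i]) : `|complex.Re z| <= normc z.
Proof.
case: z => x y /=; rewrite -sqrtr_sqr ler_wsqrtr// lerDl; exact: sqr_ge0.
Qed.

Lemma le_Im_normc (z : R[i]) : `|complex.Im z| <= normc z.
Proof.
case: z => x y /=; rewrite -sqrtr_sqr ler_wsqrtr// lerDr; exact: sqr_ge0.
Qed.

Lemma normc_le_add (z : R[i]) : normc z <= `|complex.Re z| + `|complex.Im z|.
Proof.
case: z => x y /=; rewrite -[X in _ <= X]ger0_norm ?addr_ge0// -sqrtr_sqr ler_wsqrtr//.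
rewrite -[x ^+ 2]real_normK ?num_real// -[y ^+ 2]real_normK ?num_real//.
by have := mulr_ge0 (normr_ge0 x) (normr_ge0 y); nra.
Qed.

Lemma normc_sqr_ReIm (z : R[i]) : normc z ^+ 2 = complex.Re z ^+ 2 + complex.Im z ^+ 2.
Proof. by case: z => x y /=; rewrite sqr_sqrtr// addr_ge0 ?sqr_ge0. Qed.

End ComplexModulus.

Section RieszCondition.
Context {R : realType}.
Local Notation leb := (@lebesgue_measure R).
Local Notation leb2 := (lebesgue2 R).

(** Riesz's characterisation of the functions with derivative in
    [L^2_loc]; a degenerate interval contributes [0 / 0 = 0]. *)
Definition riesz_bounded (f : R -> R) : Prop :=
  forall N, 0 < N -> exists C, forall (n : nat) (t : nat -> R),
    (forall k, (k <= n)%N -> `|t k| <= N) ->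
    (forall k, (k < n)%N -> t k <= t k.+1) ->
    \sum_(k < n) (f (t k.+1) - f (t k)) ^+ 2 / (t k.+1 - t k) <= C.

(** Bessel's inequality for the orthogonal increments of the Cauchy kernel, whose
    scalar products with the d-bar derivative are the increments of [u]. *)
Lemma dbar_pair_riesz (u v b1 b2 : R * R -> R) : dbar_pair u v b1 b2 ->
  riesz_bounded (fun x => u (x, 0)).
Proof.
move=> uv N N0; have [al1 [al2 [[m1 m2] al0 ial pompeiu]]] := localised_cauchy_pompeiu uv N0.
set A := \int[leb2]_p ((al1 p ^+ 2 + al2 p ^+ 2) / `|p.2|).
set c0 := @pker_mass R; have c00 : 0 < c0 by exact: pker_mass_gt0.
set kap := @energy_cst R; have kap0 : 0 <= kap by exact: energy_cst_ge0.
exists (A * (kap + 1) / c0 ^+ 2) => n t tN tS.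
pose Du k := u (t k.+1, 0) - u (t k, 0).
pose dt k := t k.+1 - t k.
have dt0 k : (k < n)%N -> 0 <= dt k by move=> kn; rewrite subr_ge0 tS.
rewrite [X in X <= _](_ : _ = \sum_(k < n) Du k ^+ 2 / dt k)//.
set S := \sum_(k < n) Du k ^+ 2 / dt k.
have bessel (c : nat -> R) : 2 * (c0 * \sum_(k < n) c k * Du k) <=
    A + kap * \sum_(k < n) c k ^+ 2 * dt k.
  have HQ := has_integral_pole_sum c tS.
  have HL : has_integral leb2
      (fun p => \sum_(k < n) c k * (al1 p * kre 0 (t k) p - al2 p * kim 0 (t k) p +
         - (al1 p * kre 0 (t k.+1) p - al2 p * kim 0 (t k.+1) p)))
      (\sum_(k < n) c k * (- (u (t k, 0) * c0) - - (u (t k.+1, 0) * c0))).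
    apply: (@has_integral_sum _ _ _ leb2 n (fun k p => c k *
      (al1 p * kre 0 (t k) p - al2 p * kim 0 (t k) p +
       - (al1 p * kre 0 (t k.+1) p - al2 p * kim 0 (t k.+1) p)))
      (fun k => c k * (- (u (t k, 0) * c0) - - (u (t k.+1, 0) * c0)))) => k kn.
    apply: has_integralZ; apply: has_integralD; first by apply/pompeiu/tN/ltnW.
    by apply: has_integralN; apply/pompeiu/tN.
  have := has_integral_le (has_integralZ 2 HL)
    (has_integralD (has_integral_Rintegral ial) HQ).
  rewrite -/A -/kap (_ : \sum_(k < n) _ = c0 * \sum_(k < n) c k * Du k); last first.
    by rewrite mulr_sumr; apply: eq_bigr => k _; rewrite /Du; ring.
  apply=> p; rewrite (_ : \sum_(k < n) _ = al1 p * pole_sum (kre 0) n c t p -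
      al2 p * pole_sum (kim 0) n c t p); last first.
    rewrite /pole_sum !mulr_sumr -sumrB; apply: eq_bigr => k _; ring.
  set Q1 := pole_sum _ _ _ _ _; set Q2 := pole_sum _ _ _ _ _.
  have [y0|y0] := eqVneq p.2 0.
    have [-> ->] := al0 p y0.
    by rewrite !mul0r subrr mulr0 expr0n addr0 mul0r add0r mulr_ge0// addr_ge0 ?sqr_ge0.
  have y1 : 0 < `|p.2| by rewrite normr_gt0.
  rewrite -subr_ge0.
  rewrite (_ : _ - _ = ((al1 p - `|p.2| * Q1) ^+ 2 + (al2 p + `|p.2| * Q2) ^+ 2) / `|p.2|).
    by rewrite divr_ge0 ?addr_ge0 ?sqr_ge0.
  by field; rewrite gt_eqF.
(* [c k = lam * Du k / dt k] is, up to the safety margin [+ 1] which avoids a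
   division by [0], the choice that maximises the left side of [bessel] minus
   the sum on its right. *)
pose lam := c0 / (kap + 1); have k1 : 0 < kap + 1 by rewrite ltr_wpDl.
have lam0 : 0 < lam by rewrite divr_gt0.
have := bessel (fun k => lam * (Du k / dt k)).
rewrite (_ : \sum_(k < n) _ = lam * S); last first.
  by rewrite /S mulr_sumr; apply: eq_bigr => k _; ring.
rewrite (_ : \sum_(k < n) _ ^+ 2 * _ = lam ^+ 2 * S); last first.
  rewrite /S mulr_sumr; apply: eq_bigr => k _; have [->|d0] := eqVneq (dt k) 0.
    by rewrite invr0 !mulr0.
  by field.
have S0 : 0 <= S.
  by apply: sumr_ge0 => k _; rewrite divr_ge0 ?sqr_ge0 ?dt0.
move=> B; rewrite ler_pdivlMr ?exprn_gt0// -ler_pdivrMr//.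
apply: le_trans (_ : _ <= 2 * (c0 * (lam * S)) - kap * (lam ^+ 2 * S)) _; last by lra.
rewrite -subr_ge0 (_ : _ - _ = S * lam ^+ 2).
  by rewrite mulr_ge0 ?sqr_ge0.
by rewrite /lam; field; rewrite gt_eqF.
Qed.

(** [2 |b - a| <= d + (b - a)^2 / d] on each interval of length [d]. *)
Lemma riesz_rectifiable (gamma : R -> R[i]^o) :
  riesz_bounded (fun x => complex.Re (gamma x)) ->
  riesz_bounded (fun x => complex.Im (gamma x)) ->
  locally_rectifiable gamma.
Proof.
move=> rre rim I _ [B [_ /(_ (`|B| + 1))]].
rewrite (le_lt_trans (ler_norm B)) ?ltrDl// => /(_ isT) IB.
set N := `|B| + 1; have N0 : 0 < N by rewrite ltr_wpDl.
have [C1 HC1] := rre _ N0; have [C2 HC2] := rim _ N0.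
apply: (@le_lt_trans _ _ (2 * N + (C1 + C2) / 2)%:E); last exact: ltry.
apply: ge_ereal_sup => _ [n [t [tI tS ->]]]; rewrite lee_fin.
have tN k : (k <= n)%N -> `|t k| <= N by move=> kn; apply: IB; exact: tI.
have amgm (a b d : R) : 0 <= d -> (d = 0 -> b = a) ->
    `|b - a| <= (d + (b - a) ^+ 2 / d) / 2.
  rewrite le_eqVlt eq_sym => /predU1P[-> /(_ erefl)->|d0 _].
    by rewrite subrr normr0 expr0n mul0r addr0 mul0r.
  rewrite ler_pdivlMr// -(ler_pM2r d0) mulrDl divfK ?gt_eqF//.
  rewrite -[(b - a) ^+ 2]real_normK ?num_real//.
  by have := sqr_ge0 (d - `|b - a|); nra.
have tsum : \sum_(k < n) (t k.+1 - t k) = t n - t 0%N.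
  by rewrite -(big_mkord xpredT (fun k => t k.+1 - t k)) telescope_sumr.
apply: (@le_trans _ _ (\sum_(k < n) ((t k.+1 - t k) +
  ((complex.Re (gamma (t k.+1)) - complex.Re (gamma (t k))) ^+ 2 / (t k.+1 - t k) +
   (complex.Im (gamma (t k.+1)) - complex.Im (gamma (t k))) ^+ 2 / (t k.+1 - t k)) / 2))).
  apply: ler_sum => k _; apply: le_trans (normc_le_add _) _.
  have d0 : 0 <= t k.+1 - t k by rewrite subr_ge0 tS.
  have dE (f : R -> R) : t k.+1 - t k = 0 -> f (t k.+1) = f (t k).
    by move=> /eqP; rewrite subr_eq0 => /eqP ->.
  have H1 := amgm _ _ _ d0 (dE (fun x => complex.Re (gamma x))).
  have H2 := amgm _ _ _ d0 (dE (fun x => complex.Im (gamma x))).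
  have -> : complex.Re (gamma (t k.+1) - gamma (t k)) =
    complex.Re (gamma (t k.+1)) - complex.Re (gamma (t k)) by rewrite raddfB.
  have -> : complex.Im (gamma (t k.+1) - gamma (t k)) =
    complex.Im (gamma (t k.+1)) - complex.Im (gamma (t k)) by rewrite raddfB.
  by apply: le_trans (lerD H1 H2) _; lra.
rewrite big_split/= tsum -mulr_suml big_split/=.
have := HC1 n t tN tS; have := HC2 n t tN tS.
have := tN n (leqnn n); have := tN 0%N (leq0n n).
by rewrite !ler_norml; lra.
Qed.

End RieszCondition.

(** * Dyadic difference quotients *)

Section DyadicQuotients.
Context {R : realType}.
Local Notation leb := (@lebesgue_measure R).

Lemma sum_ord_mul (K p : nat) (F : nat -> R) :
  \sum_(k < K * p) F k = \sum_(i < K) \sum_(r < p) F (i * p + r)%N.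
Proof.
elim: K => [|K IH]; first by rewrite mul0n !big_ord0.
rewrite big_ord_recr/= -IH mulSnr.
by rewrite big_split_ord/=.
Qed.

Lemma ge0_integral_steps (a h : R) (K : nat) (f : R -> R) (F : nat -> R) :
  0 <= h -> measurable_fun setT f ->
  (forall k x, (k < K)%N -> a + k%:R * h <= x < a + k.+1%:R * h -> f x = F k) ->
  (forall x, 0 <= f x) ->
  (\int[leb]_(x in `[a, (a + K%:R * h)%R[) (f x)%:E = (\sum_(k < K) F k * h)%:E)%E.
Proof.
move=> h0 mf fF f0; elim: K fF => [|K IH] fF.
  rewrite big_ord0 mul0r addr0 set_itvco0 //; exact: integral_set0.
have lt1 : a <= a + K%:R * h by rewrite lerDl mulr_ge0.
have lt2 : a + K%:R * h <= a + K.+1%:R * h by rewrite lerD2l ler_wpM2r// ler_nat.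
rewrite (@itv_bndbnd_setU _ _ _ (BLeft (a + K%:R * h))) ?bnd_simp//.
rewrite ge0_integral_setU//=; last 3 first.
- by apply/measurable_EFinP; exact: measurable_funTS.
- by move=> x _; rewrite lee_fin.
- apply/disj_setPS => x [/=]; rewrite !in_itv/= => /andP[_ x1] /andP[x2 _].
  by have := lt_le_trans x1 x2; rewrite ltxx.
rewrite IH; last by move=> k x kK; apply: fF; exact: ltnW.
rewrite (eq_integral (fun=> (F K)%:E)); last first.
  by move=> x; rewrite inE/= in_itv/= => xK; rewrite (fF K).
rewrite integral_cst//= lebesgue_measure_itv/= lte_fin [in RHS]big_ord_recr/= [in RHS]EFinD.
congr (_ + _)%E; case: ltP => [_|].
  by rewrite -EFinB -EFinM; congr EFin; rewrite -natr1; ring.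
rewrite lerD2l -natr1 mulrDl mul1r gerDl => h1.
by rewrite mule0 (_ : h = 0) ?mulr0//; apply/le_anti; rewrite h0 h1.
Qed.

Definition dyadic_floor (n : nat) (x : R) : R := (Num.floor (2 ^+ n * x))%:~R / 2 ^+ n.

Lemma pow2_gt0 n : 0 < 2 ^+ n :> R.
Proof. exact: exprn_gt0. Qed.
Hint Resolve pow2_gt0 : core.

Lemma dyadic_floor_itv n x : dyadic_floor n x <= x < dyadic_floor n x + 2 ^- n.
Proof.
have /andP[f1 f2] := floor_itv (2 ^+ n * x).
rewrite /dyadic_floor ler_pdivrMr// mulrC [x * _]mulrC f1/=.
have -> : (Num.floor (2 ^+ n * x))%:~R / 2 ^+ n + 2 ^- n =
  (Num.floor (2 ^+ n * x) + 1)%:~R / 2 ^+ n :> R.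
  by rewrite intrD mulrDl mul1r.
by rewrite ltr_pdivlMr// mulrC.
Qed.

Lemma measurable_dyadic_floor n : measurable_fun setT (dyadic_floor n).
Proof.
apply: nondecreasing_measurable => // x y xy.
rewrite /dyadic_floor ler_pM2r ?invr_gt0// ler_int.
by apply: le_floor; rewrite ler_pM2l.
Qed.

Lemma dyadic_floorD n x : dyadic_floor n (x + 2 ^- n) = dyadic_floor n x + 2 ^- n.
Proof.
rewrite /dyadic_floor mulrDr divff ?gt_eqF// floorDrz ?int_num1//.
by rewrite floor1 intrD mulrDl mul1r.
Qed.

Lemma cvg_dyadic_floor x : (fun n => dyadic_floor n x) @ \oo --> x.
Proof.
apply: (@squeeze_cvgr _ _ _ _ (fun n => x - 2 ^- n) (fun=> x)).
- near=> n; have /andP[-> /ltW] := dyadic_floor_itv n x.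
  by rewrite -lerBlDr => ->.
- rewrite -[X in _ --> X]subr0; apply: cvgB; first exact: cvg_cst.
  rewrite [X in X @ _ --> _](_ : _ = (fun n => 2^-1 ^+ n)); last first.
    by apply/funext => n; rewrite exprVn.
  by apply: cvg_expr; rewrite ger0_norm// invf_lt1 ?ltr1n.
- exact: cvg_cst.
Unshelve. all: by end_near. Qed.

Context (u : R -> R) (cu : continuous u).

(** For increasing [n] these form a martingale on each dyadic interval. *)
Definition dyadic_quot (n : nat) (x : R) : R :=
  (u (dyadic_floor n x + 2 ^- n) - u (dyadic_floor n x)) * 2 ^+ n.

Lemma measurable_dyadic_comp n c :
  measurable_fun setT (fun x => u (dyadic_floor n x + c)).
Proof.
apply: (measurableT_comp (continuous_measurable_fun cu)).
have := measurable_dyadic_floor n => ?; measurable_arith.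
Qed.

Lemma measurable_dyadic_quot n : measurable_fun setT (dyadic_quot n).
Proof.
have m1 := measurable_dyadic_comp n (2 ^- n).
have m0 : measurable_fun setT (fun x => u (dyadic_floor n x)).
  exact: measurableT_comp (continuous_measurable_fun cu) (measurable_dyadic_floor n).
rewrite /dyadic_quot; measurable_arith.
Qed.

Definition node (N n k : nat) : R := - N%:R + k%:R * 2 ^- n.

Definition riesz_sum (N n : nat) : R :=
  \sum_(k < 2 * N * 2 ^ n) (u (node N n k.+1) - u (node N n k)) ^+ 2 * 2 ^+ n.

Lemma dyadic_floor_node N n k x : node N n k <= x < node N n k.+1 ->
  dyadic_floor n x = node N n k.
Proof.
move=> /andP[x1 x2].
rewrite /dyadic_floor (@floor_def _ _ (- (N * 2 ^ n)%:Z + k%:Z)).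
  rewrite /node intrD mulrDl -!pmulrn rmorphN/= -pmulrn mulNr natrM natrX.
  by rewrite mulfK ?gt_eqF.
move: x1 x2; rewrite /node => x1 x2.
have e z : (- (N * 2 ^ n)%:Z + z%:Z)%:~R = 2 ^+ n * (- N%:R + z%:R * 2 ^- n) :> R.
  rewrite intrD rmorphN/= -!pmulrn natrM natrX mulrDr mulrCA divff ?gt_eqF// mulr1.
  by rewrite mulrN mulrC.
have -> : - (N * 2 ^ n)%:Z + k%:Z + 1 = - (N * 2 ^ n)%:Z + k.+1%:Z.
  by lia.
by rewrite !e ler_pM2l// x1 ltr_pM2l.
Qed.

Lemma dyadic_quot_node N n k x : node N n k <= x < node N n k.+1 ->
  dyadic_quot n x = (u (node N n k.+1) - u (node N n k)) * 2 ^+ n.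
Proof.
move=> xk; rewrite /dyadic_quot (dyadic_floor_node xk).
by rewrite (_ : node N n k + _ = node N n k.+1)// /node -natr1; ring.
Qed.

Lemma node_refine N n j i : node N n i = node N (n + j) (i * 2 ^ j).
Proof.
rewrite /node natrM natrX exprD invfM; congr (_ + _).
by rewrite -mulrA [2 ^+ j * _]mulrCA divff ?gt_eqF// mulr1.
Qed.

Lemma node_le N n k l : (k <= l)%N -> node N n k <= node N n l.
Proof. by move=> kl; rewrite lerD2l ler_wpM2r ?invr_ge0 ?ler_nat// ltW. Qed.

Lemma dyadic_quot_node_refine N n j k x :
  node N (n + j) k <= x < node N (n + j) k.+1 ->
  dyadic_quot n x =
    (u (node N n (k %/ 2 ^ j).+1) - u (node N n (k %/ 2 ^ j))) * 2 ^+ n.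
Proof.
move=> /andP[x1 x2]; apply: dyadic_quot_node.
rewrite !(node_refine _ n j) (le_trans _ x1) ?node_le ?leq_trunc_div//=.
by rewrite (lt_le_trans x2)// node_le// ltn_ceil// expn_gt0.
Qed.

Lemma node0 N n : node N n 0 = - N%:R.
Proof. by rewrite /node mul0r addr0. Qed.

Lemma node_last N n : node N n (2 * N * 2 ^ n) = N%:R.
Proof.
rewrite /node !natrM natrX mulfK ?gt_eqF//; ring.
Qed.

Lemma integral_dyadic_quot_sqr N n :
  (\int[leb]_(x in `[(- N%:R)%R, N%:R%R[) (dyadic_quot n x ^+ 2)%:E =
   (riesz_sum N n)%:E)%E.
Proof.
rewrite -{2}(node_last N n) {1}/node.
rewrite (@ge0_integral_steps _ _ _ _
  (fun k => ((u (node N n k.+1) - u (node N n k)) * 2 ^+ n) ^+ 2)).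
- congr EFin; apply: eq_bigr => k _; rewrite exprMn -mulrA; congr (_ * _).
  by rewrite expr2 -mulrA divff ?mulr1// gt_eqF.
- by rewrite invr_ge0 ltW.
- by have := measurable_dyadic_quot n => ?; measurable_arith.
- by move=> k x _ xk; rewrite (dyadic_quot_node xk).
- by move=> x; exact: sqr_ge0.
Qed.

(** On each dyadic interval the coarse quotient is the mean of the fine one, so
    the difference is orthogonal to the coarse quotient and Pythagoras applies. *)
Lemma integral_dyadic_quot_diff N n j :
  (\int[leb]_(x in `[(- N%:R)%R, N%:R%R[)
      ((dyadic_quot (n + j) x - dyadic_quot n x) ^+ 2)%:E =
   (riesz_sum N (n + j) - riesz_sum N n)%:E)%E.
Proof.
rewrite -{2}(node_last N (n + j)) {1}/node.
pose a k := u (node N (n + j) k.+1) - u (node N (n + j) k).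
pose b i := u (node N n i.+1) - u (node N n i).
have bE i : b i = \sum_(r < 2 ^ j) a (i * 2 ^ j + r)%N.
  rewrite -(big_mkord xpredT (fun r => a (i * 2 ^ j + r)%N)) /a.
  under eq_bigr do rewrite -addnS.
  rewrite (telescope_sumr (fun r => u (node N (n + j) (i * 2 ^ j + r)))) ?leq0n//.
  by rewrite addn0 /b !(node_refine N n j) mulSnr.
rewrite (@ge0_integral_steps _ _ _ _
  (fun k => (a k * 2 ^+ (n + j) - b (k %/ 2 ^ j)%N * 2 ^+ n) ^+ 2)); last 4 first.
- by rewrite invr_ge0 ltW.
- have := measurable_dyadic_quot n; have := measurable_dyadic_quot (n + j) => ? ?.
  measurable_arith.
- by move=> k x _ xk; rewrite (dyadic_quot_node xk) (dyadic_quot_node_refine xk).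
- by move=> x; exact: sqr_ge0.
congr EFin; rewrite /riesz_sum expnD mulnA.
rewrite (sum_ord_mul _ _ (fun k => (a k * 2 ^+ (n + j) - b (k %/ 2 ^ j)%N * 2 ^+ n) ^+ 2 / 2 ^+ (n + j))).
rewrite (sum_ord_mul _ _ (fun k => a k ^+ 2 * 2 ^+ (n + j))).
rewrite -sumrB; apply: eq_bigr => i _; rewrite -/(b i).
transitivity (\sum_(r < 2 ^ j) (a (i * 2 ^ j + r)%N ^+ 2 * 2 ^+ (n + j) -
    2 * b i * 2 ^+ n * a (i * 2 ^ j + r)%N + b i ^+ 2 * 2 ^+ n / 2 ^+ j)).
  apply: eq_bigr => r _; rewrite divnMDl ?expn_gt0// divn_small// addn0 exprD.
  have := pow2_gt0 n; have := pow2_gt0 j.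
  by move: (2 ^+ n) (2 ^+ j) => p q q0 p0; field; rewrite !gt_eqF.
rewrite big_split/= sumrB -mulr_sumr -bE sumr_const card_ord.
rewrite -[X in _ + X]mulr_natr natrX divfK ?gt_eqF//; ring.
Qed.

Lemma riesz_sum_nd N : nondecreasing_seq (riesz_sum N).
Proof.
move=> n m nm; rewrite -(subnKC nm) -subr_ge0 -lee_fin -integral_dyadic_quot_diff.
by apply: integral_ge0 => x _; rewrite lee_fin sqr_ge0.
Qed.

Lemma riesz_sum_bounded N : riesz_bounded u -> exists C, forall n, riesz_sum N n <= C.
Proof.
case: N => [_|N ru].
  by exists 0 => n; rewrite /riesz_sum muln0 mul0n big_ord0.
have [//|C HC] := ru N.+1%:R; exists C => n.
apply: le_trans (HC (2 * N.+1 * 2 ^ n)%N (node N.+1 n) _ _).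
- rewrite le_eqVlt; apply/orP; left; apply/eqP; apply: eq_bigr => k _.
  congr (_ * _); rewrite /node -natr1; set x := 2 ^- n.
  by rewrite -[2 ^+ n]invrK -/x; congr (_^-1); ring.
- move=> k kK; rewrite ler_norml -{1}(node0 N.+1 n) node_le//=.
  by rewrite -[X in _ <= X](node_last N.+1 n) node_le.
- by move=> k _; exact: node_le.
Qed.

End DyadicQuotients.

(** * The limit of the dyadic difference quotients *)

Lemma ae_mono d (T : measurableType d) (R : realType)
    (mu : {measure set T -> \bar R}) (P Q : T -> Prop) :
  (forall x, P x -> Q x) -> {ae mu, forall x, P x} -> {ae mu, forall x, Q x}.
Proof.
by move=> PQ; apply: filterS => //; exact: (ae_filter_ringOfSetsType mu).
Qed.

Section DyadicLimit.
Context {R : realType}.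
Local Notation leb := (@lebesgue_measure R).
Context (u : R -> R) (cu : continuous u) (ru : riesz_bounded u).

Local Notation dq := (dyadic_quot u).
Local Notation itvN N := (`[(- N%:R)%R, N%:R%R[%classic).

Let leb_itvN (N : nat) : leb (itvN N) = (2 * N%:R)%:E.
Proof.
rewrite lebesgue_measure_itv/= lte_fin; case: ltP => [_|].
  by rewrite -EFinB; congr EFin; ring.
move=> N0; have := ler0n R N => N1.
by rewrite (_ : N%:R = 0) ?mulr0//; lra.
Qed.

(** The sums are nondecreasing and bounded, hence convergent; the level [s k] is
    chosen for the window [-k <= x < k], and these windows exhaust the line. *)
Lemma riesz_sum_subsequence : exists s : nat -> nat,
  [/\ forall k, (k <= s k)%N, forall k, (s k <= s k.+1)%N &
      forall k m, (s k <= m)%N ->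
        riesz_sum u k m - riesz_sum u k (s k) <= 16 ^- k].
Proof.
have exc k : exists c, forall m, (c <= m)%N ->
    riesz_sum u k m - riesz_sum u k c <= 16 ^- k.
  have [C HC] := riesz_sum_bounded k ru.
  have hs : has_sup (range (riesz_sum u k)).
    by split; [exists (riesz_sum u k 0), 0%N|exists C => _ [n _ <-]].
  have e0 : 0 < 16 ^- k :> R by rewrite invr_gt0 exprn_gt0.
  have [_ [c _ <-] cP] := sup_adherent e0 hs.
  exists c => m _; have : riesz_sum u k m <= sup (range (riesz_sum u k)).
    by apply: ub_le_sup; [exact: hs.2|exists m].
  by move: cP; lra.
have [c HC] := choice exc.
exists (fun k => \sum_(i < k.+1) (c i).+1)%N; split.
- elim=> [//|k IH]; rewrite big_ord_recr/=; apply: leq_trans (leq_add IH (ltn0Sn _)).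
  by rewrite addn1.
- by move=> k; rewrite [in X in (_ <= X)%N]big_ord_recr leq_addr.
- move=> k m km; set n := (\sum_(i < _) _)%N in km *.
  have cn : (c k <= n)%N.
    by rewrite /n big_ord_recr/= (leq_trans (leqnSn _))// leq_addl.
  have := HC k m (leq_trans cn km).
  by have := riesz_sum_nd cu k cn; lra.
Qed.

Context (s : nat -> nat) (s_nd : forall k, (s k <= s k.+1)%N).
Context (s_small : forall k m, (s k <= m)%N ->
  riesz_sum u k m - riesz_sum u k (s k) <= 16 ^- k).

(** Successive differences along [s]: their [L^1] norm over [-k <= x < k] decays
    geometrically, which gives convergence almost everywhere. *)
Let D k x := dq (s k.+1) x - dq (s k) x.

Let mD k : measurable_fun setT (D k).
Proof.
have := measurable_dyadic_quot cu (s k.+1); have := measurable_dyadic_quot cu (s k).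
by move=> ? ?; rewrite /D; measurable_arith.
Qed.

Let sub_itvN (N k : nat) : (N <= k)%N -> (itvN N : set R) `<=` itvN k.
Proof.
move=> Nk x; rewrite /= !in_itv/= => /andP[x1 x2].
have : N%:R <= k%:R :> R by rewrite ler_nat.
by move=> H; apply/andP; split; lra.
Qed.

Let integral_D (N k : nat) : (N <= k)%N ->
  (\int[leb]_(x in itvN N) `|D k x|%:E <= (8 / (2 ^ k.+1)%:R)%:E)%E.
Proof.
move=> Nk.
apply: (@le_trans _ _ (\int[leb]_(x in itvN k) `|D k x|%:E)%E).
  apply: ge0_subset_integral => //.
  - by apply/measurable_EFinP; apply: measurable_funTS; have := mD k => ?; measurable_arith.
  - exact: sub_itvN.
have e0 : 0 < 4 ^+ k :> R by rewrite exprn_gt0.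
(* the weight [4 ^ k] balances [leb (itvN k) <= 2 ^ k.+1] and [16 ^- k] *)
apply: (@le_trans _ _ (\int[leb]_(x in itvN k) (4 ^- k + 4 ^+ k * D k x ^+ 2)%:E)%E).
  apply: ge0_le_integral => //.
  - by apply/measurable_EFinP; apply: measurable_funTS; have := mD k => ?; measurable_arith.
  - by apply/measurable_EFinP; apply: measurable_funTS; have := mD k => ?; measurable_arith.
  - move=> x _; rewrite lee_fin -[D k x ^+ 2]real_normK ?num_real//.
    rewrite -(ler_pM2l e0) mulrDr divff ?gt_eqF//.
    have := sqr_ge0 (2 * (4 ^+ k * `|D k x|) - 1); nra.
rewrite (eq_integral (fun x : measurableTypeR R => ((4 ^- k)%:E + (4 ^+ k * D k x ^+ 2)%:E)%E))//.
rewrite ge0_integralD//; last 2 first.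
- by move=> x _; rewrite lee_fin mulr_ge0 ?sqr_ge0 ?ltW.
- by apply/measurable_EFinP; apply: measurable_funTS; have := mD k => ?; measurable_arith.
rewrite integral_cst// [X in (_ * X + _ <= _)%E](leb_itvN k : _ = _) -EFinM.
rewrite (eq_integral (fun x : measurableTypeR R => ((4 ^+ k)%:E * (D k x ^+ 2)%:E)%E))//.
rewrite ge0_integralZl_EFin ?(ltW e0)//; last 2 first.
- by move=> x _; rewrite lee_fin sqr_ge0.
- by apply/measurable_EFinP; apply: measurable_funTS; have := mD k => ?; measurable_arith.
have -> : (\int[leb]_(x in itvN k) (D k x ^+ 2)%:E =
    (riesz_sum u k (s k.+1) - riesz_sum u k (s k))%:E)%E.
  rewrite /D -[in LHS](subnKC (s_nd k)) integral_dyadic_quot_diff//.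
  by rewrite subnKC.
rewrite -EFinM -EFinD lee_fin.
have H := s_small (s_nd k).
apply: (@le_trans _ _ (4 ^- k * (2 * 2 ^+ k) + 4 ^+ k * 16 ^- k)).
  apply: lerD; last by rewrite ler_pM2l.
  rewrite ler_pM2l ?invr_gt0// ler_pM2l// -natrX ler_nat.
  exact/ltnW/ltn_expl.
have p0 : 0 < 2 ^+ k :> R by rewrite exprn_gt0.
have -> : 4 = 2 ^+ 2 :> R by ring.
have -> : 16 = 2 ^+ 4 :> R by ring.
rewrite natrX [X in _ <= 8 / X]exprS -!exprM ![(_ * k)%N]mulnC !exprM.
have p1 : 1 <= 2 ^+ k :> R by rewrite exprn_ege1// ler1n.
move: (2 ^+ k) p0 p1 => p p0 p1.
rewrite -subr_ge0 (_ : _ - _ = (2 * p - 1) / p ^+ 2).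
  by rewrite divr_ge0 ?sqr_ge0//; lra.
by field; rewrite gt_eqF.
Qed.

Let dq_telescope N i x : dq (s (N + i)) x = dq (s N) x + \sum_(l < i) D (N + l) x.
Proof.
elim: i => [|i IH]; first by rewrite addn0 big_ord0 addr0.
by rewrite big_ord_recr/= addrA -IH /D addnS addrC subrK.
Qed.

(** An integrable majorant on [itvN N] of all quotients of index at least [N],
    whose finiteness forces convergence. *)
Let majorant (N : nat) (x : R) : \bar R :=
  (`|dq (s N) x|%:E + \sum_(i <oo) `|D (N + i) x|%:E)%E.

Let majorant_ge0 N x : (0 <= majorant N x)%E.
Proof. by rewrite adde_ge0 ?lee_fin// nneseries_ge0. Qed.

Let measurable_norm_D k : measurable_fun setT (fun x => `|D k x|%:E).
Proof. by have := mD k => ?; measurable_arith. Qed.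

Let measurable_tail N :
  measurable_fun setT (fun x => \sum_(i <oo) `|D (N + i) x|%:E)%E.
Proof.
apply: ge0_emeasurable_sum => [k x _ _|k _]; first by rewrite lee_fin.
exact: measurable_norm_D.
Qed.

Let measurable_majorant N : measurable_fun setT (majorant N).
Proof.
apply: emeasurable_funD.
  by have := measurable_dyadic_quot cu (s N) => ?; measurable_arith.
exact: measurable_tail.
Qed.

Let le_majorant N k x : (N <= k)%N -> (`|dq (s k) x|%:E <= majorant N x)%E.
Proof.
move=> Nk; rewrite -(subnKC Nk) dq_telescope.
apply: (@le_trans _ _ (`|dq (s N) x|%:E + \sum_(0 <= l < k - N) `|D (N + l) x|%:E)%E).
  rewrite sumEFin -EFinD lee_fin big_mkord.
  by apply: le_trans (ler_normD _ _) _; rewrite lerD2l ler_norm_sum.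
by rewrite leeD2l//; apply: nneseries_lim_ge => i _ _; rewrite lee_fin.
Qed.

Let majorant_cvg N x : (majorant N x < +oo)%E -> cvgn (fun k => dq (s k) x).
Proof.
move=> Hx; have c : cvgn (fun i => dq (s (N + i)) x).
  have nc : cvgn [normed series (fun i => D (N + i) x)].
    apply: nondecreasing_is_cvgn.
      by apply: nondecreasing_series => i _ _; exact: normr_ge0.
    exists (fine (majorant N x)) => _ [n _ <-].
    rewrite -lee_fin fineK; last by rewrite ge0_fin_numE.
    rewrite /series/= -sumEFin; apply: le_trans (leeDr _ _); last by rewrite lee_fin.
    by apply: nneseries_lim_ge => i _ _; rewrite lee_fin.
  have := normed_cvg nc => /cvg_ex[l Dl]; apply/cvg_ex; exists (dq (s N) x + l).
  under eq_fun do rewrite dq_telescope.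
  apply: cvgD; first exact: cvg_cst.
  by move: Dl; rewrite /series/=; under eq_fun do rewrite big_mkord.
move/cvg_ex: c => [l cl]; apply/cvg_ex; exists l.
rewrite -(cvg_shiftn N) /=; move: cl.
by under eq_fun do rewrite addnC.
Qed.

Let integral_majorant N : (\int[leb]_(x in itvN N) majorant N x < +oo)%E.
Proof.
rewrite ge0_integralD//; last 3 first.
- apply/measurable_EFinP; apply: measurable_funTS.
  by have := measurable_dyadic_quot cu (s N) => ?; measurable_arith.
- by move=> x _; exact: nneseries_ge0.
- apply: measurable_funTS.
  exact: measurable_tail.
apply: lte_add_pinfty.
  apply: (@le_lt_trans _ _ (\int[leb]_(x in itvN N) (1%:E + (dq (s N) x ^+ 2)%:E))%E).
    apply: ge0_le_integral => //.
    - apply/measurable_EFinP; apply: measurable_funTS.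
      by have := measurable_dyadic_quot cu (s N) => ?; measurable_arith.
    - apply: measurable_funTS.
      apply: emeasurable_funD => //.
      by have := measurable_dyadic_quot cu (s N) => ?; measurable_arith.
    - move=> x _; rewrite -EFinD lee_fin -[_ ^+ 2]real_normK ?num_real//.
      by have := sqr_ge0 (`|dq (s N) x| - 1); nra.
  rewrite ge0_integralD//; last 2 first.
  - by move=> x _; rewrite lee_fin sqr_ge0.
  - apply/measurable_EFinP; apply: measurable_funTS.
    by have := measurable_dyadic_quot cu (s N) => ?; measurable_arith.
  rewrite integral_cst// [X in (_ * X + _ < _)%E](leb_itvN N : _ = _).
  by rewrite integral_dyadic_quot_sqr// -EFinM -EFinD ltry.
rewrite integral_nneseries//; last first.
  by move=> i; apply: measurable_funTS; exact: measurable_norm_D.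
apply: (@le_lt_trans _ _ (\sum_(i <oo) (8 / (2 ^ i.+1)%:R)%:E)%E); last first.
  exact: le_lt_trans (epsilon_trick0 xpredT (ler0n _ 8)) (ltry _).
apply: lee_nneseries => [i _ _|i _]; first by apply: integral_ge0 => x _; rewrite lee_fin.
apply: le_trans (integral_D (leq_addr _ _)) _.
rewrite lee_fin ler_pM2l// lef_pV2 ?posrE ?ltr0n ?expn_gt0//.
by rewrite ler_nat leq_exp2l// ltnS leq_addl.
Qed.

(** The limit where it exists; [fine] of the upper limit is measurable
    everywhere. *)
Let g (x : R) : R := fine (limn_esup (fun k => (dq (s k) x)%:E)).

Let measurable_g : measurable_fun setT g.
Proof.
apply: (measurableT_comp (fine_measurable measurableT)).
apply: measurable_fun_limn_esup => k.
by apply/measurable_EFinP; exact: measurable_dyadic_quot.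
Qed.

Let cvg_g N x : (majorant N x < +oo)%E -> (fun k => dq (s k) x) @ \oo --> g x.
Proof.
move=> /majorant_cvg/cvg_ex[l cl]; suff -> : g x = l by [].
have cE : (fun k => (dq (s k) x)%:E) @ \oo --> l%:E.
  by apply: cvg_EFin; [exact: nearW|].
rewrite /g is_cvg_limn_esupE; last by apply/cvg_ex; exists l%:E.
by move/cvg_lim : cE => ->.
Qed.

Let majorant_integrable N : leb.-integrable (itvN N) (majorant N).
Proof.
apply/integrableP; split.
  by apply: measurable_funTS; exact: measurable_majorant.
under eq_integral do rewrite gee0_abs ?majorant_ge0//.
exact: integral_majorant.
Qed.

Let ae_cvg_g N : {ae leb, forall x, itvN N x -> (fun k => dq (s k) x) @ \oo --> g x}.
Proof.
have H0 : {ae leb, forall x, itvN N x -> majorant N x \is a fin_num}.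
  by apply: integrable_ae (majorant_integrable N); exact: measurable_itv.
apply: ae_mono H0 => x H /H; rewrite ge0_fin_numE ?majorant_ge0// => Hx.
exact: cvg_g Hx.
Qed.

(** Fatou's lemma along the subsequence. *)
Let integral_g_sqr N : (\int[leb]_(x in itvN N) (g x ^+ 2)%:E < +oo)%E.
Proof.
have [C HC] := riesz_sum_bounded N ru.
have mq k : measurable_fun (itvN N : set (measurableTypeR R)) (fun x => (dq (s k) x ^+ 2)%:E).
  apply/measurable_EFinP; apply: measurable_funTS.
  by have := measurable_dyadic_quot cu (s k) => ?; measurable_arith.
apply: (@le_lt_trans _ _ C%:E); last exact: ltry.
apply: (@le_trans _ _ (\int[leb]_(x in itvN N)
    limn_einf (fun k => (dq (s k) x ^+ 2)%:E))%E).
  apply: ae_ge0_le_integral => //.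
  - by move=> x _; rewrite lee_fin sqr_ge0.
  - apply/measurable_EFinP; apply: measurable_funTS.
    by have := measurable_g => ?; measurable_arith.
  - move=> x _; rewrite limn_einf_lim; apply: lime_ge; first exact: is_cvg_einfs.
    by apply: nearW => k; apply: le_ereal_inf_tmp => _ [m _ <-]; rewrite lee_fin sqr_ge0.
  - rewrite (_ : (fun x => limn_einf _) =
      (fun x => - limn_esup (fun k => - (dq (s k) x ^+ 2)%:E))%E); last first.
      by apply/funext => x; rewrite limn_esupN oppeK.
    apply: measurableT_comp => //; apply: measurable_fun_limn_esup => k.
    by apply: measurableT_comp => //; exact: mq.
  apply: ae_mono (ae_cvg_g N) => x H /H cx.
  have c2 : (fun k => (dq (s k) x ^+ 2)%:E) @ \oo --> (g x ^+ 2)%:E.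
    apply: cvg_EFin; first exact: nearW.
    by under eq_fun do rewrite expr2; apply: cvgM.
  rewrite is_cvg_limn_einfE; last by apply/cvg_ex; exists (g x ^+ 2)%:E.
  by move/cvg_lim : c2 => ->.
apply: (@le_trans _ _ (limn_einf
    (fun k => \int[leb]_(x in itvN N) (dq (s k) x ^+ 2)%:E))%E).
  by apply: fatou => // k x _; rewrite lee_fin sqr_ge0.
rewrite limn_einf_lim; apply: lime_le; first exact: is_cvg_einfs.
apply: nearW => k; apply: ge_ereal_inf; exists (riesz_sum u N (s k))%:E.
  by exists k => //=; rewrite integral_dyadic_quot_sqr.
by rewrite lee_fin.
Qed.

Let weak_limit N (psi : R -> R) : measurable_fun setT psi ->
  (exists C, forall x, `|psi x| <= C) -> (forall x, ~ itvN N x -> psi x = 0) ->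
  (fun k => \int[leb]_x (dq (s k) x * psi x)) @ \oo --> \int[leb]_x (g x * psi x).
Proof.
move=> mpsi [C HC] psi0.
have C0 : 0 <= C by apply: le_trans (HC 0).
have restr (f : R -> R) : \int[leb]_x (f x * psi x) = \int[leb]_(x in itvN N) (f x * psi x).
  rewrite [RHS]Rintegral_mkcond; apply: eq_Rintegral => x _; rewrite patchE.
  by case: ifPn => // /negP xN; rewrite psi0 ?mulr0// => /mem_set.
rewrite restr; under eq_fun do rewrite restr.
suff c : (fun k => \int[leb]_(x in itvN N) (dq (s (k + N)) x * psi x)) @ \oo -->
    \int[leb]_(x in itvN N) (g x * psi x).
  by have := cvg_shiftn N (fun k => \int[leb]_(x in itvN N) (dq (s k) x * psi x))
    (nbhs (\int[leb]_(x in itvN N) (g x * psi x))) => E; exact: (eq_ind _ id c _ E).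
pose I : set (measurableTypeR R) := itvN N.
have mI : measurable I by exact: measurable_itv.
have mf k : measurable_fun I (fun x => (dq (s (k + N)) x * psi x)%:E).
  apply/measurable_EFinP; apply: measurable_funTS.
  by have := measurable_dyadic_quot cu (s (k + N)) => ?; measurable_arith.
have mg : measurable_fun I (fun x => (g x * psi x)%:E).
  apply/measurable_EFinP; apply: measurable_funTS.
  by have := measurable_g => ?; measurable_arith.
have cf : {ae leb, forall x, I x ->
    (fun k => (dq (s (k + N)) x * psi x)%:E) @ \oo --> (g x * psi x)%:E}.
  apply: ae_mono (ae_cvg_g N) => x H /H cx.
  apply: cvg_EFin; first exact: nearW.
  apply: cvgM; last exact: cvg_cst.
  by have := cvg_shiftn N (fun k => dq (s k) x) (nbhs (g x)) => ->.
have im : leb.-integrable I (fun x => C%:E * majorant N x)%E.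
  by apply: integrableZl => //; exact: majorant_integrable.
have fm : {ae leb, forall x (k : nat), I x ->
    (`|(dq (s (k + N)) x * psi x)%:E| <= C%:E * majorant N x)%E}.
  apply: aeW => x k _; rewrite EFinM abseM muleC.
  rewrite lee_pmul//; first by rewrite lee_fin.
  exact: le_majorant (leq_addl _ _).
have [if_ _ c] := dominated_convergence mI mf mg cf im fm.
apply: fine_cvg; rewrite fineK; first exact: c.
exact: integrable_fin_num.
Qed.

(** An L^2-bounded martingale converges; one limit [g] serves for all the
    windows [-N <= x < N]. *)
Lemma dyadic_quot_limit : exists g : R -> R, [/\ measurable_fun setT g,
  forall N : nat, (\int[leb]_(x in itvN N) (g x ^+ 2)%:E < +oo)%E &
  forall N (psi : R -> R), measurable_fun setT psi ->
    (exists C, forall x, `|psi x| <= C) -> (forall x, ~ itvN N x -> psi x = 0) ->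
    (fun k => \int[leb]_x (dq (s k) x * psi x)) @ \oo --> \int[leb]_x (g x * psi x)].
Proof. by exists g; split => // N psi; exact: weak_limit. Qed.

End DyadicLimit.

(** * The weak derivative of a function satisfying the Riesz condition *)

Section WeakDerivative.
Context {R : realType}.
Local Notation leb := (@lebesgue_measure R).
Local Notation itvN N := (`[(- N%:R)%R, N%:R%R[%classic).

Lemma integral_shift (f : R -> \bar R) (h : R) : measurable_fun setT f ->
  (\int[leb]_x f (x + h)%R = \int[leb]_x f x)%E.
Proof.
move=> mf.
have ge0_shift (k : R -> \bar R) : measurable_fun setT k -> (forall x, 0 <= k x)%E ->
    (\int[leb]_x k (x + h)%R = \int[leb]_x k x)%E.
  move=> mk k0; rewrite -(@ge0_integral_affine _ 1 h k)// mul1e.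
  by apply: eq_integral => x _; rewrite mul1r.
have H1 := ge0_shift _ (measurable_funepos mf) (fun x => funepos_ge0 f x).
have H2 := ge0_shift _ (measurable_funeneg mf) (fun x => funeneg_ge0 f x).
rewrite [RHS]integralE -H1 -H2 integralE.
by congr (_ - _)%E; apply: eq_integral => x _; rewrite ?funeposE ?funenegE.
Qed.

Lemma bounded_itvN_integrable (f : R -> R) (C : R) (N : nat) :
  measurable_fun setT f -> (forall x, `|f x| <= C) ->
  (forall x, ~ (itvN N : set R) x -> f x = 0) ->
  leb.-integrable setT (EFin \o f).
Proof.
move=> mf fC f0; have C0 : 0 <= C by apply: le_trans (fC 0).
have iI := integrable_indic_itv (- N%:R : R) N%:R true true.
refine (@integrable_dominated _ _ _ leb f (fun x => C * \1_(itvN N) x) mf _ _).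
  exact: (has_integralZ C (has_integral_Rintegral iI)).1.
move=> x; rewrite indicE; have [/set_mem xN|/negP xN] := boolP (x \in _).
  by rewrite mulr1.
by rewrite f0 ?normr0 ?mulr0// => xN'; apply: xN; exact/mem_set.
Qed.

Lemma test_function_bounded_supp (phi : R -> R) : test_function phi ->
  exists N : nat, forall x, N%:R <= `|x| -> phi x = 0.
Proof.
move=> [_ /compact_bounded[M [_ /(_ (`|M| + 1))]]].
rewrite (le_lt_trans (ler_norm M)) ?ltrDl// => /(_ isT) HM.
have [N MN] : exists N : nat, `|M| + 1 < N%:R.
  by exists (Num.bound (`|M| + 1)); apply: archi_boundP; rewrite addr_ge0.
exists N => x Nx; apply/eqP/negPn/negP => px.
have /HM : closure [set x | phi x != 0] x by exact: subset_closure.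
by rewrite /= => xM; have := lt_le_trans (le_lt_trans xM MN) Nx; rewrite ltxx.
Qed.

Context (u : R -> R) (cu : continuous u) (ru : riesz_bounded u).

Section TestFunction.
Context (phi : R -> R) (tphi : test_function phi).
Context (N : nat) (phi0 : forall x, N%:R <= `|x| -> phi x = 0).

Let sphi : smooth phi. Proof. by case: tphi. Qed.
Let cphi : continuous phi. Proof. exact: smooth_continuous. Qed.
Let mphi : measurable_fun setT phi. Proof. exact: continuous_measurable_fun. Qed.

Let le1 n : 0 < (2 ^- n : R) <= 1.
Proof. by rewrite invr_gt0 exprn_gt0//= invf_le1 ?exprn_ege1 ?exprn_gt0// ler1n. Qed.

Let phi0S n x : ~ (itvN N.+1 : set R) x -> phi (x - 2 ^- n) = 0 /\ phi x = 0.
Proof.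
move=> xN; have /andP[h0 h1] := le1 n.
have [x1|x1] := ltP x (- N.+1%:R).
  by split; apply: phi0; rewrite ler_normr -natr1 in x1 *; apply/orP; right; lra.
have {x1}x2 : N.+1%:R <= x.
  by rewrite leNgt; apply/negP => x2; apply: xN; rewrite /= in_itv/= x1 x2.
by split; apply: phi0; rewrite ler_normr -natr1 in x2 *; apply/orP; left; lra.
Qed.

Let u_bound : exists2 C, 0 <= C & forall n x, (itvN N.+1 : set R) x ->
  `|u (dyadic_floor n x)| <= C /\ `|u (dyadic_floor n x + 2 ^- n)| <= C.
Proof.
have : compact (u @` `[- N.+2%:R, N.+2%:R]).
  apply: continuous_compact; last exact: segment_compact.
  exact: continuous_subspaceT.
move=> /compact_bounded[A [_ /(_ (`|A| + 1))]].
rewrite (le_lt_trans (ler_norm A)) ?ltrDl// => /(_ isT) uA.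
exists (`|A| + 1); first by rewrite addr_ge0.
move=> n x; rewrite /= in_itv/= => /andP[x1 x2].
have /andP[h0 h1] := le1 n; have /andP[f1 f2] := dyadic_floor_itv n x.
have e : N.+2%:R = N.+1%:R + 1 :> R by rewrite natr1.
by split; apply: uA; eexists; try reflexivity; rewrite /= in_itv/=; lra.
Qed.

Let phi_bound : exists2 C, 0 <= C & forall x, `|phi x| <= C.
Proof.
by apply: (continuous_supp_bounded (M := N%:R)) => // x /ltW; exact: phi0.
Qed.

Let phi_lip : exists2 C, 0 <= C & forall n x,
  `|(phi x - phi (x - 2 ^- n)) * 2 ^+ n| <= C.
Proof.
have sd := smooth_D1 sphi.
have [C C0 HC] : exists2 C, 0 <= C & forall x, `|'D_1 phi x| <= C.
  apply: (continuous_supp_bounded (M := N%:R)); first exact: smooth_continuous.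
  by apply: derive_eq0_beyond => x /ltW; exact: phi0.
exists C => // n x; have /andP[h0 h1] := le1 n.
have [|||c _ ->] := @MVT_segment _ phi ('D_1 phi) (x - 2 ^- n) x.
- by rewrite gerBl ltW.
- by move=> y _; apply: DeriveDef => //; exact: smooth_derivable.
- by apply: continuous_subspaceT.
by rewrite opprB addrC subrK -mulrA mulVf ?mulr1.
Qed.

(** Summation by parts: translating by [2 ^- n] moves the difference quotient from
    [u] to [phi]. *)
Let quot_by_parts n : \int[leb]_x (dyadic_quot u n x * phi x) =
  - \int[leb]_x (u (dyadic_floor n x) * ((phi x - phi (x - 2 ^- n)) * 2 ^+ n)).
Proof.
have [Cu Cu0 uC] := u_bound; have [Cp Cp0 pC] := phi_bound.
have mfl : measurable_fun setT (dyadic_floor n : R -> R) := measurable_dyadic_floor n.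
have mu0 : measurable_fun setT (fun x => u (dyadic_floor n x)).
  exact: (measurableT_comp (continuous_measurable_fun cu) mfl).
have mu1 := measurable_dyadic_comp cu n (2 ^- n).
have mphi1 : measurable_fun setT (fun x : R => phi (x - 2 ^- n)).
  by apply: (measurableT_comp mphi); measurable_arith.
have int_ (w q : R -> R) : measurable_fun setT w -> measurable_fun setT q ->
    (forall x, (itvN N.+1 : set R) x -> `|w x| <= Cu) -> (forall x, `|q x| <= Cp) ->
    (forall x, ~ (itvN N.+1 : set R) x -> q x = 0) ->
    leb.-integrable setT (EFin \o (fun x => w x * q x)).
  move=> mw mq wC qC q0; apply: (@bounded_itvN_integrable _ (Cu * Cp) N.+1).
  - exact: measurable_funM.
  - move=> x; rewrite normrM; have [xN|xN] := pselect ((itvN N.+1 : set R) x).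
      by rewrite ler_pM ?wC.
    by rewrite q0// normr0 mulr0 mulr_ge0.
  - by move=> x xN; rewrite q0// mulr0.
have i0 : leb.-integrable setT (EFin \o (fun x => u (dyadic_floor n x) * phi x)).
  by apply: int_ => // x xN; [exact: (uC n x xN).1|exact: (phi0S n xN).2].
have i1 : leb.-integrable setT (EFin \o (fun x => u (dyadic_floor n x + 2 ^- n) * phi x)).
  by apply: int_ => // x xN; [exact: (uC n x xN).2|exact: (phi0S n xN).2].
have i2 : leb.-integrable setT (EFin \o (fun x => u (dyadic_floor n x) * phi (x - 2 ^- n))).
  by apply: int_ => // x xN; [exact: (uC n x xN).1|exact: (phi0S n xN).1].
have shift : \int[leb]_x (u (dyadic_floor n x + 2 ^- n) * phi x) =
    \int[leb]_x (u (dyadic_floor n x) * phi (x - 2 ^- n)).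
  rewrite /Rintegral -[in RHS](@integral_shift _ (2 ^- n)); last first.
    by apply/measurable_EFinP; exact: measurable_funM.
  by congr fine; apply: eq_integral => x _; rewrite dyadic_floorD addrK.
have H1 := has_integralZ (2 ^+ n) (has_integralD (has_integral_Rintegral i1)
  (has_integralN (has_integral_Rintegral i0))).
have H2 := has_integralN (has_integralZ (2 ^+ n) (has_integralD
  (has_integral_Rintegral i0) (has_integralN (has_integral_Rintegral i2)))).
transitivity (2 ^+ n * (\int[leb]_x (u (dyadic_floor n x + 2 ^- n) * phi x) -
    \int[leb]_x (u (dyadic_floor n x) * phi x))).
  rewrite -H1.2; apply: eq_Rintegral => x _; rewrite /dyadic_quot; ring.
rewrite shift -opprB mulrN -(has_integralZ (2 ^+ n) (has_integralD
  (has_integral_Rintegral i0) (has_integralN (has_integral_Rintegral i2)))).2.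
by congr (- _); apply: eq_Rintegral => x _; ring.
Qed.

Lemma cvg_integral_dyadic_quot :
  (fun n => \int[leb]_x (dyadic_quot u n x * phi x)) @ \oo -->
  - \int[leb]_x (u x * 'D_1 phi x).
Proof.
under eq_fun do rewrite quot_by_parts; apply: cvgN.
have [Cu Cu0 uC] := u_bound; have [Cl Cl0 lC] := phi_lip.
have mu : measurable_fun setT u by exact: continuous_measurable_fun.
have mD : measurable_fun setT ('D_1 phi).
  by apply: continuous_measurable_fun; apply/smooth_continuous/smooth_D1.
have iI := integrable_indic_itv (- N.+1%:R : R) N.+1%:R true true.
have iC := (has_integralZ (Cu * Cl) (has_integral_Rintegral iI)).1.
have [] // := @Rintegral_dominated_cvg _ _ _ leb
  (fun n x => u (dyadic_floor n x) * ((phi x - phi (x - 2 ^- n)) * 2 ^+ n))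
  (fun x => u x * 'D_1 phi x) (fun x => Cu * Cl * \1_(itvN N.+1) x) _ _ iC _ _.
- move=> n; have mfl : measurable_fun setT (dyadic_floor n : R -> R) := measurable_dyadic_floor n.
  have mu0 : measurable_fun setT (fun x => u (dyadic_floor n x)).
    exact: (measurableT_comp mu mfl).
  have mphi1 : measurable_fun setT (fun x : R => phi (x - 2 ^- n)).
    by apply: (measurableT_comp mphi); measurable_arith.
  measurable_arith.
- exact: measurable_funM.
- move=> n x; rewrite indicE; have [/set_mem xN|/negP xN] := boolP (x \in _).
    by rewrite mulr1 normrM ler_pM//; exact: (uC n x xN).1.
  have [-> ->] := phi0S n (fun h => xN (mem_set h)).
  by rewrite subrr mul0r mulr0 normr0 mulr0.
move=> x; apply: cvgM.
  by apply: continuous_cvg; [exact: cu|exact: cvg_dyadic_floor].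
have dx : derivable phi x 1 by exact: smooth_derivable.
have c0 : (fun n => - 2 ^- n : R) @ \oo --> (0 : R).
  rewrite -oppr0; apply: cvgN.
  rewrite [X in X @ _ --> _](_ : _ = (fun n => 2^-1 ^+ n)); last first.
    by apply/funext => n; rewrite exprVn.
  by apply: cvg_expr; rewrite ger0_norm// invf_lt1 ?ltr1n.
have h0 : (fun n => - 2 ^- n : R) @ \oo --> 0^'.
  move=> A A0; have HA : \forall n \near \oo, (- 2 ^- n : R) != 0 -> A (- 2 ^- n : R).
    exact: (c0 _ A0).
  suff : \forall n \near \oo, A (- 2 ^- n : R) by [].
  apply: filterS HA => n; apply.
  by rewrite oppr_eq0 gt_eqF//; have /andP[] := le1 n.
have := cvg_comp _ _ h0 dx; apply: cvg_trans; apply: near_eq_cvg; near=> n.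
rewrite /= -[_ *: _]/(_ * _) [_ *: 1]mulr1 invrN invrK addrC.
by rewrite [- 2 ^- n + x]addrC; ring.
Unshelve. all: by end_near. Qed.

End TestFunction.

Lemma riesz_weak_derivative : exists g : R -> R, [/\ measurable_fun setT g,
  forall N : nat, (\int[leb]_(x in itvN N) (g x ^+ 2)%:E < +oo)%E &
  weak_deriv_line u g].
Proof.
have [s [s_ge s_nd s_small]] := riesz_sum_subsequence cu ru.
have [g [mg g2 glim]] := dyadic_quot_limit cu ru s_nd s_small.
exists g; split=> // phi tphi; have sphi : smooth phi by case: tphi.
have [N phi0] := test_function_bounded_supp tphi.
have lim1 := cvg_integral_dyadic_quot tphi phi0.
have s_oo : s @ \oo --> \oo.
  move=> A [n _ An]; exists n => // k /= nk; apply: An; exact: leq_trans nk (s_ge k).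
have lim2 := cvg_comp _ _ s_oo lim1.
have lim3 : ((fun n => \int[leb]_x (dyadic_quot u n x * phi x)) \o s) @ \oo -->
    \int[leb]_x (g x * phi x).
  apply: (glim N).
  - by apply: continuous_measurable_fun; exact: smooth_continuous.
  - have [|C _ HC] := @continuous_supp_bounded _ phi N%:R (smooth_continuous sphi).
      by move=> x /ltW; exact: phi0.
    by exists C.
  - move=> x xN; apply: phi0; rewrite leNgt; apply/negP => xN'; apply: xN.
    by move: xN'; rewrite ltr_norml => /andP[x1 x2]; rewrite /= in_itv/= ltW.
exact: (canRL opprK (cvg_unique _ lim2 lim3)).
Qed.

End WeakDerivative.

(** * Continuity and measurability in the plane *)

Section ComplexPlane.
Context {R : realType}.
Local Notation C := R[i]^o.

Lemma continuous_Re : continuous (fun z : C => complex.Re z).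
Proof.
move=> z; apply/(@cvgrPdist_lt _ R^o _ _ (nbhs_filter z)) => e e0.
have H : \forall w \near z, `|z - w : C| < e%:C.
  by have := nbhsx_ballx z (e%:C : R[i]); rewrite -ball_normE; apply; rewrite ltcR.
apply: filterS H => w zw; rewrite -raddfB.
by apply: (le_lt_trans (le_Re_normc _)); rewrite -ltcR.
Qed.

Lemma continuous_Im : continuous (fun z : C => complex.Im z).
Proof.
move=> z; apply/(@cvgrPdist_lt _ R^o _ _ (nbhs_filter z)) => e e0.
have H : \forall w \near z, `|z - w : C| < e%:C.
  by have := nbhsx_ballx z (e%:C : R[i]); rewrite -ball_normE; apply; rewrite ltcR.
apply: filterS H => w zw; rewrite -raddfB.
by apply: (le_lt_trans (le_Im_normc _)); rewrite -ltcR.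
Qed.

Lemma continuous_toC : continuous (@toC R).
Proof.
move=> p; apply/cvgrPdist_lt => e; case: e => a b; rewrite ltcE/= => /andP[/eqP -> a0].
near=> q; rewrite -[X in X < _]/((normc (toC p - toC q))%:C) ltcR.
apply: (le_lt_trans (normc_le_add _)) => /=.
rewrite [a]splitr ltrD//; near: q.
  by apply: cvgr_dist_lt; [exact: cvg_fst|exact: divr_gt0].
by apply: cvgr_dist_lt; [exact: cvg_snd|exact: divr_gt0].
Unshelve. all: by end_near. Qed.

(** Freezing the first variable on a fine grid makes the preimages countable
    unions of measurable rectangles. *)
Lemma continuous_measurable_fun2 (f : R * R -> R) : continuous f ->
  measurable_fun setT f.
Proof.
move=> cf.
apply: (@measurable_fun_cvg _ _ _ setT (fun n p => f (dyadic_floor n p.1, p.2))); last first.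
  move=> p _; have c1 : (fun n => dyadic_floor n p.1) @ \oo --> p.1 by exact: cvg_dyadic_floor.
  have c2 : (fun _ : nat => p.2) @ \oo --> p.2 by exact: cvg_cst.
  apply: continuous_cvg; first exact: cf.
  by have := cvg_pair c1 c2; case: p {c1 c2} => x y /=; apply.
move=> n _ Y mY; rewrite setTI.
rewrite (_ : _ @^-1` Y = \bigcup_(k : int)
  ((dyadic_floor n @^-1` [set k%:~R / 2 ^+ n]) `*`
   ((fun y => f (k%:~R / 2 ^+ n, y)) @^-1` Y))); last first.
  apply/seteqP; split=> [[x y] /= Yxy|[x y] [k _ [/= <- //]]].
  by exists (Num.floor (2 ^+ n * x)).
apply: countable_bigcupT_measurable; first exact: countableP.
move=> k; apply: measurableX.
  rewrite -[X in measurable X]setTI; exact: (@measurable_dyadic_floor R n measurableT _ (measurable_set1 _)).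
have cy : continuous (fun y : R => f (k%:~R / 2 ^+ n, y)).
  move=> y.
  have c1 : (fun _ : R => k%:~R / 2 ^+ n : R) @ y --> (k%:~R / 2 ^+ n : R) by exact: cvg_cst.
  have c2 : (fun y : R => y) @ y --> y by exact: cvg_id.
  have c3 := cvg_pair c1 c2.
  exact: (cvg_comp _ _ (c3 _ _ _) (cf (k%:~R / 2 ^+ n, y))).
rewrite -[X in measurable X]setTI.
exact: (continuous_measurable_fun cy measurableT mY).
Qed.

End ComplexPlane.

(** * Sobolev functions and their d-bar derivative *)

Section SobolevInterface.
Context {R : realType}.
Local Notation leb := (@lebesgue_measure R).
Local Notation leb2 := (lebesgue2 R).
Local Notation C := R[i]^o.

Lemma smooth_derive (f : R * R -> R) v : smooth f -> smooth ('D_v f).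
Proof. by move=> sf n; have [_ /(_ v)[]] := sf n.+1. Qed.

(** [f] is its own product with the indicator function of the box. *)
Lemma bounded_mfun_box M (f : R * R -> R) : continuous f -> box_supp M f ->
  bounded_mfun f.
Proof.
move=> cf fM; have mf := continuous_measurable_fun2 cf.
pose one (p : R * R) : R := if (M < `|p.1|) || (M < `|p.2|) then 0 else 1.
have mone : measurable_fun setT one.
  apply: measurable_fun_ifT => //; apply: measurable_or;
    apply: measurable_fun_ltr => //; measurable_arith.
have b1 : bounded_mfun one.
  by split=> //; exists 1 => p; rewrite /one; case: ifP; rewrite ?normr0 ?normr1.
have box1 : box_supp M one by move=> p pM; rewrite /one pM.
have := continuous_box_bounded cf mf b1 box1.
congr bounded_mfun; apply/funext => p; rewrite /one.
by case: ifP => [/fM ->|_]; rewrite ?mul0r ?mulr1.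
Qed.

Lemma test_function_box (f : R * R -> R) : test_function f -> exists M,
  [/\ bounded_mfun f, box_supp M f &
      forall v, bounded_mfun ('D_v f) /\ box_supp M ('D_v f)].
Proof.
move=> [sf /compact_bounded[B [_ /(_ (`|B| + 1))]]].
rewrite (le_lt_trans (ler_norm B)) ?ltrDl// => /(_ isT) HB.
pose M := `|B| + 1; exists M.
have out p : (M < `|p.1|) || (M < `|p.2|) -> ~ closure [set p | f p != 0] p.
  move=> pM /HB /=; rewrite -/M [`|p|]/(Num.max `|p.1| `|p.2|) ge_max.
  by move: pM; rewrite !ltNge -negb_and => /negP.
have fM : box_supp M f.
  move=> p /out pc; apply/eqP/negPn/negP => fp; apply: pc.
  exact: subset_closure.
have cf := smooth_continuous sf.
have DM v : box_supp M ('D_v f).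
  move=> p /out pc; rewrite (@near_eq_derive _ _ _ f (cst 0)) ?derive_cst//.
  move: pc => /existsNP[U /not_implyP[Up]] /set0P/negP/negPn/eqP UA.
  apply: filterS Up => q Uq; apply/eqP/negPn/negP => fq.
  by have : ([set p | f p != 0] `&` U) q by []; rewrite UA.
split=> //; first exact: bounded_mfun_box cf fM.
by move=> v; split=> //; apply: bounded_mfun_box (DM v); apply/smooth_continuous/smooth_derive.
Qed.

Lemma L2loc_mul_integrable (g : C -> C) M (f : R * R -> R) : L2loc_plane g ->
  bounded_mfun f -> box_supp M f ->
  leb2.-integrable setT (EFin \o (fun p => complex.Re (g (toC p)) * f p)) /\
  leb2.-integrable setT (EFin \o (fun p => complex.Im (g (toC p)) * f p)).
Proof.
move=> [[mRe mIm] gK] [mf [B fB]] fM.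
pose K : set (R * R) := `[- M, M]%classic `*` `[- M, M]%classic.
have mK : measurable K by apply: measurableX; exact: measurable_itv.
have outK p : ~ K p -> f p = 0.
  move=> pK; apply: fM; apply/negPn/negP; rewrite negb_or -!leNgt => /andP[p1 p2].
  by apply: pK; split; rewrite /= in_itv/= -ler_norml.
have B0 : 0 <= B by apply: le_trans (fB (0, 0)).
have m1K : measurable_fun setT (\1_K : R * R -> R) by exact: measurable_indic.
have b1K : bounded_mfun (\1_K : R * R -> R).
  by split=> //; exists 1 => p; rewrite indicE ger0_norm ?ler0n// lern1 leq_b1.
have i1 : leb2.-integrable setT (EFin \o (\1_K : R * R -> R)).
  apply: (bounded_mfun_integrable (M := M) b1K) => p pM.
  rewrite indicE memNset// => -[/=]; rewrite !in_itv/= -!ler_norml => p1 p2.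
  by move: pM; rewrite !ltNge p1 p2.
pose h p := normc (g (toC p)) ^+ 2 * \1_K p.
have mn : measurable_fun setT (fun p : R * R => normc (g (toC p)) ^+ 2).
  under eq_fun do rewrite normc_sqr_ReIm.
  by apply: measurable_funD; apply: measurable_funX.
have i2 : leb2.-integrable setT (EFin \o h).
  apply: integrable_ge0.
  - exact: measurable_funM mn m1K.
  - by move=> p; rewrite mulr_ge0 ?sqr_ge0// indicE.
  have gM := gK _ (@compact_box R M).
  refine (le_lt_trans _ gM).
  rewrite [leRHS]integral_mkcond le_eqVlt; apply/orP; left; apply/eqP.
  apply: eq_integral => p _; rewrite patchE /h indicE.
  by case: ifP => _; rewrite ?mulr1 ?mulr0.
have dom (w : R * R -> R) : measurable_fun setT w ->
    (forall p, `|w p| <= normc (g (toC p))) ->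
    leb2.-integrable setT (EFin \o (fun p => w p * f p)).
  move=> mw wg.
  have iD := (has_integralZ B (has_integralD (has_integral_Rintegral i1)
    (has_integral_Rintegral i2))).1.
  refine (@integrable_dominated _ _ _ leb2 (fun p => w p * f p) _ _ iD _).
    exact: measurable_funM.
  move=> p; rewrite /h indicE; have [/set_mem pK|/negP pK] := boolP (p \in K); last first.
    rewrite outK ?mulr0 ?normr0 ?addr0 ?mulr0// => pK'.
    by apply: pK; exact/mem_set.
  rewrite mulr1 normrM mulrC ler_pM//; apply: (le_trans (wg p)).
  by rewrite mulr1n; have := sqr_ge0 (normc (g (toC p)) - 1); nra.
by split; apply: dom => // p; [exact: le_Re_normc|exact: le_Im_normc].
Qed.

(** Multiplication of [u + i v] by [- i]: whatever holds for the real part of such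
    a function holds for its imaginary part. *)
Lemma dbar_pair_rot (u v b1 b2 : R * R -> R) : dbar_pair u v b1 b2 ->
  dbar_pair v (fun p => - u p) b2 (fun p => - b1 p).
Proof.
case=> cu cv mu mv m1 m2 z I green; split=> //.
- by move=> p; apply: cvgN; exact: cu.
- exact: measurable_funN.
- exact: measurable_funN.
- by move=> p /z[-> ->]; rewrite oppr0.
- by under eq_integral do rewrite sqrrN addrC.
move=> f g tf tg.
have tNf : test_function (fun p => - f p).
  case: tf => sf cf; split; first exact: smoothN.
  congr (compact (closure _)): cf; apply/funext => p /=.
  by rewrite oppr_eq0.
have DN w p : 'D_w (fun p => - f p) p = - 'D_w f p.
  by case: tf => sf _; rewrite deriveN//; exact: smooth_derivable.
have := green g (fun p => - f p) tg tNf.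
under eq_Rintegral do rewrite mulrN opprK.
under [in X in _ = - X -> _]eq_Rintegral do rewrite !DN opprK.
under [in X in _ -> X = _]eq_Rintegral do rewrite mulNr opprK.
under [in X in _ -> _ = - X]eq_Rintegral do rewrite mulNr opprK.
move=> E.
transitivity (\int[leb2]_p (b1 p * g p + b2 p * f p)).
  by apply: eq_Rintegral => p _; rewrite addrC.
by rewrite E; congr (- _); apply: eq_Rintegral => p _; ring.
Qed.

End SobolevInterface.

Section DbarOfSobolev.
Context {R : realType}.
Local Notation leb := (@lebesgue_measure R).
Local Notation leb2 := (lebesgue2 R).
Local Notation C := R[i]^o.

Lemma lebesgue2_real_axis : leb2 [set p | p.2 = 0] = 0%E.
Proof.
rewrite (_ : [set p | p.2 = 0] = setT `*` [set 0]); last first.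
  by apply/seteqP; split=> [[x y] /= ->|[x y] /= [_ ->]].
rewrite [LHS]product_measure1E//.
by rewrite /= lebesgue_measure_set1 mule0.
Qed.

Lemma eq_Rintegral_off_axis (f g : R * R -> R) : measurable_fun setT f ->
  measurable_fun setT g -> (forall p, p.2 != 0 -> f p = g p) ->
  \int[leb2]_p f p = \int[leb2]_p g p.
Proof.
move=> mf mg fg; congr fine; apply: ae_eq_integral => //.
- exact/measurable_EFinP.
- exact/measurable_EFinP.
exists [set p | p.2 = 0]; split; last 1 first.
- move=> p /= nfg; apply: contrapT => /eqP p0; apply: nfg => _.
  by rewrite fg.
- rewrite (_ : [set p | p.2 = 0] = setT `&` snd @^-1` [set (0 : R)]) ?setTI//.
  rewrite -[X in measurable X]setTI.
  by apply: (@measurable_snd _ _ R R) => //; exact: measurable_set1.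
- exact: lebesgue2_real_axis.
Qed.

Lemma normc_delbar (rx ry : C -> C) z : 4 * normc (delbar rx ry z) ^+ 2 =
  (complex.Re (rx z) - complex.Im (ry z)) ^+ 2 +
  (complex.Im (rx z) + complex.Re (ry z)) ^+ 2.
Proof.
have half : (2^-1 : C) = (2^-1 : R)%:C by rewrite fmorphV rmorph_nat.
rewrite normc_sqr_ReIm /delbar half.
by case: (rx z) (ry z) => [a b] [c d] /=; field.
Qed.

Context (rho rx ry : C -> C) (crho : continuous rho) (W : W12loc rho rx ry).

Let u p := complex.Re (rho (toC p)).
Let v p := complex.Im (rho (toC p)).
Let B1 p := complex.Re (rx (toC p)) - complex.Im (ry (toC p)).
Let B2 p := complex.Im (rx (toC p)) + complex.Re (ry (toC p)).

Let cu : continuous u.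
Proof.
move=> p; apply: (@continuous_comp _ _ _ (rho \o toC) _ p); last exact: continuous_Re.
by apply: continuous_comp; [exact: continuous_toC|exact: crho].
Qed.

Let cv : continuous v.
Proof.
move=> p; apply: (@continuous_comp _ _ _ (rho \o toC) _ p); last exact: continuous_Im.
by apply: continuous_comp; [exact: continuous_toC|exact: crho].
Qed.

Let mu := continuous_measurable_fun2 cu.
Let mv := continuous_measurable_fun2 cv.

Let mB : measurable_fun setT B1 /\ measurable_fun setT B2.
Proof.
case: W => _ [[mrx1 mrx2] _] [[mry1 mry2] _] _ _.
by split; [exact: measurable_funB|exact: measurable_funD].
Qed.

Let green f g : test_function f -> test_function g ->
  \int[leb2]_p (B1 p * f p - B2 p * g p) =
  - \int[leb2]_p (u p * ('D_(1, 0) f p - 'D_(0, 1) g p)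
                - v p * ('D_(0, 1) f p + 'D_(1, 0) g p)).
Proof.
move=> tf tg; case: W => _ Lx Ly [Wxu Wxv] [Wyu Wyv].
have [Mf [bf fM Df]] := test_function_box tf.
have [Mg [bg gM Dg]] := test_function_box tg.
have [x1f x2f] := L2loc_mul_integrable Lx bf fM.
have [y1f y2f] := L2loc_mul_integrable Ly bf fM.
have [x1g x2g] := L2loc_mul_integrable Lx bg gM.
have [y1g y2g] := L2loc_mul_integrable Ly bg gM.
have iu (w k : R * R -> R) M : continuous w -> bounded_mfun k -> box_supp M k ->
    leb2.-integrable setT (EFin \o (fun p => w p * k p)).
  move=> cw bk kM; apply: (bounded_mfun_integrable (M := M)); last exact: box_suppMr.
  exact: (continuous_box_bounded cw (continuous_measurable_fun2 cw) bk kM).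
have IL := has_integralD (has_integralD (has_integral_Rintegral x1f) (has_integralN (has_integral_Rintegral y2f)))
  (has_integralD (has_integralN (has_integral_Rintegral x2g)) (has_integralN (has_integral_Rintegral y1g))).
have IR := has_integralD
  (has_integralD (has_integral_Rintegral (iu u _ _ cu (Df (1, 0)).1 (Df (1, 0)).2))
    (has_integralN (has_integral_Rintegral (iu u _ _ cu (Dg (0, 1)).1 (Dg (0, 1)).2))))
  (has_integralD (has_integralN (has_integral_Rintegral (iu v _ _ cv (Df (0, 1)).1 (Df (0, 1)).2)))
    (has_integralN (has_integral_Rintegral (iu v _ _ cv (Dg (1, 0)).1 (Dg (1, 0)).2)))).
rewrite (Wxu f tf) (Wyu g tg) (Wyv f tf) (Wxv g tg) in IR.
have EL p : (complex.Re (rx (toC p)) * f p + - (complex.Im (ry (toC p)) * f p)) +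
    (- (complex.Im (rx (toC p)) * g p) + - (complex.Re (ry (toC p)) * g p)) =
    B1 p * f p - B2 p * g p by rewrite /B1 /B2; ring.
have ER p : (u p * 'D_(1, 0) f p + - (u p * 'D_(0, 1) g p)) +
    (- (v p * 'D_(0, 1) f p) + - (v p * 'D_(1, 0) g p)) =
    u p * ('D_(1, 0) f p - 'D_(0, 1) g p) - v p * ('D_(0, 1) f p + 'D_(1, 0) g p) by ring.
by rewrite (eq_has_integral (mu := leb2) EL IL).2 (eq_has_integral (mu := leb2) ER IR).2; ring.
Qed.

(** The quotient [p.2 / p.2] is [1] off the real axis and [0] on it: it selects the
    representative of the d-bar derivative that vanishes on the axis, which is a
    null set. *)
Lemma W12loc_dbar_pair :
  (\int[leb2]_p (normc (delbar rx ry (toC p)) ^+ 2 / `|p.2|)%:E < +oo)%E ->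
  dbar_pair u v (fun p => p.2 / p.2 * B1 p) (fun p => p.2 / p.2 * B2 p).
Proof.
move=> I; have [mB1 mB2] := mB.
have m1 : measurable_fun setT (fun p : R * R => p.2 / p.2 * B1 p) by measurable_arith.
have m2 : measurable_fun setT (fun p : R * R => p.2 / p.2 * B2 p) by measurable_arith.
split=> //.
- by move=> p ->; rewrite !mul0r.
- pose h p := normc (delbar rx ry (toC p)) ^+ 2 / `|p.2|.
  have hE p : ((p.2 / p.2 * B1 p) ^+ 2 + (p.2 / p.2 * B2 p) ^+ 2) / `|p.2| = 4 * h p.
    rewrite /h mulrA normc_delbar -/(B1 p) -/(B2 p).
    have [->|p0] := eqVneq p.2 0; first by rewrite normr0 invr0 !mulr0.
    by rewrite divff// !mul1r.
  under eq_integral do rewrite hE EFinM.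
  rewrite ge0_integralZl//; first by rewrite lte_mul_pinfty.
  + apply/measurable_EFinP.
    apply: (eq_measurable_fun (fun p : R * R => 4^-1 *
      (((p.2 / p.2 * B1 p) ^+ 2 + (p.2 / p.2 * B2 p) ^+ 2) / `|p.2|))).
      by move=> p _; rewrite hE mulrA mulVf// mul1r.
    measurable_arith.
  + by move=> p _; rewrite lee_fin divr_ge0// sqr_ge0.
move=> f g tf tg; rewrite -green//.
have mtest (k : R * R -> R) : test_function k -> measurable_fun setT k.
  by move=> [/smooth_continuous ck _]; exact: continuous_measurable_fun2.
have mf := mtest f tf; have mg := mtest g tg.
apply: eq_Rintegral_off_axis; try measurable_arith.
by move=> p p0; rewrite divff// !mul1r.
Qed.

End DbarOfSobolev.

(** * Rectifiability and square integrability of the derivative *)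

Section SquareIntegrability.
Context {R : realType}.
Local Notation leb := (@lebesgue_measure R).
Local Notation C := R[i]^o.

Lemma L2loc_line_pair (g1 g2 : R -> R) :
  measurable_fun setT g1 -> measurable_fun setT g2 ->
  (forall N : nat, (\int[leb]_(x in `[(- N%:R)%R, N%:R%R[) (g1 x ^+ 2)%:E < +oo)%E) ->
  (forall N : nat, (\int[leb]_(x in `[(- N%:R)%R, N%:R%R[) (g2 x ^+ 2)%:E < +oo)%E) ->
  L2loc_line (fun x => g1 x +i* g2 x : C).
Proof.
move=> m1 m2 I1 I2; split=> // K /[dup] /compact_measurable mK /compact_bounded.
move=> [B [_ /(_ (`|B| + 1))]].
rewrite (le_lt_trans (ler_norm B)) ?ltrDl// => /(_ isT) KB.
pose N := (Num.bound (`|B| + 1)).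
have BN : `|B| + 1 < N%:R by apply: archi_boundP; rewrite addr_ge0.
pose J : set R := `[(- N%:R)%R, N%:R%R[%classic.
have mJ : measurable J by exact: measurable_itv.
have KJ : K `<=` J.
  move=> x /KB /= xB; rewrite /J/= in_itv/=.
  by move: (le_lt_trans xB BN); rewrite ltr_norml => /andP[/ltW -> ->].
have m1X : measurable_fun J (fun x => (g1 x ^+ 2)%:E).
  by apply/measurable_EFinP/measurable_funX; exact: measurable_funTS.
have m2X : measurable_fun J (fun x => (g2 x ^+ 2)%:E).
  by apply/measurable_EFinP/measurable_funX; exact: measurable_funTS.
under eq_integral do rewrite normc_sqr_ReIm /= EFinD.
apply: (@le_lt_trans _ _ (\int[leb]_(x in J) ((g1 x ^+ 2)%:E + (g2 x ^+ 2)%:E))%E).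
  apply: ge0_subset_integral => //; first exact: emeasurable_funD.
  by move=> x _; rewrite adde_ge0// lee_fin sqr_ge0.
rewrite ge0_integralD//; [|by move=> x _; rewrite lee_fin sqr_ge0..].
by rewrite lte_add_pinfty// ?I1 ?I2.
Qed.

End SquareIntegrability.

Theorem theorem3 (R : realType) (rho rx ry : R[i]^o -> R[i]^o)
  (rho_qc : quasiconformal rho)
  (rho_infty : analytic_at_infinity rho)
  (rho_partials : W12loc rho rx ry)
  (rho_int : (\int[lebesgue2 R]_p
     (normc (delbar rx ry (toC p)) ^+ 2 / `|p.2|)%:E < +oo)%E) :
  locally_rectifiable (fun x : R => rho x%:C) /\
  exists drho : R -> R[i]^o,
    weak_derivC_line (fun x : R => rho x%:C) drho /\ L2loc_line drho.
Proof.
have crho : continuous rho by case: rho_qc => -[].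
have uv := W12loc_dbar_pair crho rho_partials rho_int.
have cline (f : R * R -> R) : continuous f -> continuous (fun x : R => f (x, 0)).
  move=> cf x; have c1 : (fun y : R => y) @ x --> x by exact: cvg_id.
  have c2 : (fun _ : R => 0 : R) @ x --> (0 : R) by exact: cvg_cst.
  have c3 := cvg_pair c1 c2.
  exact: (cvg_comp _ _ (c3 _ _ _) (cf (x, 0))).
have cu := cline _ (dbar_cu uv); have cv := cline _ (dbar_cv uv).
have ru := dbar_pair_riesz uv; have rv := dbar_pair_riesz (dbar_pair_rot uv).
split; first exact: riesz_rectifiable ru rv.
have [g1 [m1 I1 w1]] := riesz_weak_derivative cu ru.
have [g2 [m2 I2 w2]] := riesz_weak_derivative cv rv.
by exists (fun x => g1 x +i* g2 x); split; [split|exact: L2loc_line_pair].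
Qed.
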